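(* Let $p\neq 2$ be a prime, $d\ge 3$, and let $H$ be a finite $d$-generator special $p$-group of rank $\frac12 d(d-1)$. Then: (i) $\mathcal{M}(H)\cong \mathbb{Z}_p^{(\frac13 d(d-1)(d+1)-m')}$ and $\ker\beta\cong \mathbb{Z}_p^{(\frac16 d(d-1)(d-2)+m')}$, where $$m'=\log_p\frac{|\langle w^p\otimes wH' \mid w\in H\rangle|}{|\mathrm{Im}\,\Psi_2\cap\langle w^p\otimes wH'\mid w\in H\rangle|}$$ and $|\mathrm{Im}\,\Psi_2|=p^{\frac16 d(d-1)(d-2)}$. (ii) $\mathcal{M}(H)\cong\mathbb{Z}_p^{(\frac13 d(d-1)(d+1))}$ if and only if $\exp(H)=p$ and $$H\cong\langle x_1,\ldots,x_d\mid x_t^p=[x_i,x_j]^p=1,\ [x_i,x_j,x_t]=1,\ 1\le i,j,t\le d\rangle.$$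
   Context: A special $p$-group is a finite non-abelian $p$-group $H$ with $H'=Z(H)=\Phi(H)$ elementary abelian; it has rank $k$ if $|H'|=p^k$. ''$d$-generator'' means that the minimal number of generators is $d$. $\exp$ denotes the exponent, $\mathbb{Z}_p^{(r)}$ the direct product of $r$ copies of the cyclic group of order $p$, $[x,y,z]=[[x,y],z]$, and $\mathcal{M}(H)$ the Schur multiplier. If $H\cong F/R$ with $F$ free, then $\mathcal{M}(H)=(R\cap F')/[R,F]$. For $H$ of class two with $H/H'$ elementary abelian: - $\beta: H'\otimes H/H'\to\mathcal{M}(H)$ is the homomorphism $x\otimes zH'\mapsto[\tilde x,\tilde z][R,F]$, where $\tilde x,\tilde z\in F$ are preimages of $x,z$ under $F\to F/R\cong H$. - $\Psi_2: H/H'Z(H)\otimes H/H'Z(H)\otimes H/H'Z(H)\to H'\otimes H/H'$ is the homomorphism $\bar x\otimes\bar y\otimes\bar z\mapsto ([x,y]\otimes zH')+([z,x]\otimes yH')+([y,z]\otimes xH')$, where $\bar x=xH'Z(H)$, etc. The tensor products here are ordinary tensor products of abelian groups. The subgroup $\langle w^p\otimes wH'\mid w\in H\rangle$ is taken in $H'\otimes H/H'$. *)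

(* Defs.v *)
From HB Require Import structures.
From mathcomp Require Import all_boot all_fingroup all_solvable all_algebra.
From mathcomp Require Import generic_quotient.
From mathcomp Require Import finmap boolp classical_sets functions cardinality.

Set Implicit Arguments.
Unset Strict Implicit.
Unset Printing Implicit Defensive.

Local Open Scope group_scope.
Local Open Scope quotient_scope.
Local Open Scope classical_set_scope.

Definition is_subgroup (G : groupType) (A : set G) : Prop :=
  A 1 /\ forall x y, A x -> A y -> A (x * y^-1).

Definition generated (G : groupType) (A : set G) : set G :=
  smallest (@is_subgroup G) A.

Definition normal_closure (G : groupType) (A : set G) : set G :=
  generated [set u | exists2 a, A a & exists g, u = a ^ g].

Definition commutators (G : groupType) (A B : set G) : set G :=
  generated [set u | exists2 a, A a & exists2 b, B b & u = [~ a, b]].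

Definition kernel (G K : groupType) (f : G -> K) : set G := [set x | f x = 1].

Definition isomorphic (G K : groupType) (A : set G) (B : set K) : Prop :=
  exists f : G -> K,
    (forall x y, A x -> A y -> f (x * y) = f x * f y) /\ set_bij A B f.

(* The additive group of row vectors over the field with p elements. *)
Definition elementary_abelian (p r : nat) : groupType := 'rV['F_p]_r.

Lemma is_subgroup_generated (G : groupType) (A : set G) :
  is_subgroup (generated A).
Proof.
split=> [M [[]] //|x y Ax Ay M [sM AM]].
by apply: (proj2 sM); [exact: Ax | exact: Ay].
Qed.

Lemma sub_generated (G : groupType) (A : set G) : A `<=` generated A.
Proof. exact: sub_gen_smallest. Qed.

Lemma generated_min (G : groupType) (A M : set G) :
  is_subgroup M -> A `<=` M -> generated A `<=` M.
Proof. by move=> sM AM x; apply. Qed.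

Lemma is_subgroupV (G : groupType) (A : set G) x :
  is_subgroup A -> A x -> A x^-1.
Proof. by move=> [A1 AF] Ax; rewrite -div1g; apply: AF. Qed.

Lemma is_subgroupM (G : groupType) (A : set G) x y :
  is_subgroup A -> A x -> A y -> A (x * y).
Proof.
move=> sA Ax Ay; rewrite -[y]invgK; apply: (proj2 sA) => //.
exact: is_subgroupV.
Qed.

Lemma is_subgroup_normal_closure (G : groupType) (A : set G) :
  is_subgroup (normal_closure A).
Proof. exact: is_subgroup_generated. Qed.

Lemma normal_closureJ (G : groupType) (A : set G) x g :
  normal_closure A x -> normal_closure A (x ^ g).
Proof.
move=> Ax; apply: (generated_min (M := [set u | normal_closure A (u ^ g)])) Ax.
  have [N1 NF] := is_subgroup_normal_closure A.
  by split=> [|u v /= Au Av]; rewrite /= ?conj1g // conjMg conjVg; apply: NF.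
move=> _ [a Aa [h ->]] /=; apply: sub_generated.
by exists a => //; exists (h * g); rewrite conjgM.
Qed.

Lemma kernel_subgroup (G K : groupType) (f : {multiplicative G -> K}) :
  is_subgroup (kernel f).
Proof.
have f1 : f 1 = 1.
  by apply: (mulgI (f 1)); rewrite -gmulfM !mulg1.
split=> // x y fx fy; rewrite /kernel /= gmulfM fx mul1g.
by apply: (mulgI (f y)); rewrite -gmulfM mulgV f1 mulg1 fy.
Qed.

Section QuotientGroup.
Variables (G : groupType) (A : set G).

Definition coset_rel (x y : G) : bool := `[< normal_closure A (x * y^-1) >].

Let sN : is_subgroup (normal_closure A) :=
  is_subgroup_normal_closure A.

Lemma coset_rel_refl : reflexive coset_rel.
Proof. by move=> x; apply/asboolP; rewrite mulgV; case: sN. Qed.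

Lemma coset_rel_sym : symmetric coset_rel.
Proof.
suff H x y : coset_rel x y -> coset_rel y x by move=> x y; apply/idP/idP; apply: H.
by move=> /asboolP Nxy; apply/asboolP; rewrite -[y]invgK -invgM; exact: is_subgroupV sN Nxy.
Qed.

Lemma coset_rel_trans : transitive coset_rel.
Proof.
move=> y x z /asboolP Nxy /asboolP Nyz; apply/asboolP.
by rewrite -(mulgVK y x) -mulgA; exact: is_subgroupM sN Nxy Nyz.
Qed.

Canonical coset_equiv : equiv_rel G :=
  EquivRel coset_rel coset_rel_refl coset_rel_sym coset_rel_trans.

(* The quotient of G by the normal closure of A: it is G / A when A is a      *)
(* normal subgroup, and < X | A > when G is the free group on X.              *)
Definition quotg := {eq_quot coset_rel}.
HB.instance Definition _ := Choice.on quotg.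
HB.instance Definition _ := EqQuotient.on quotg.

Definition quotg_proj (x : G) : quotg := \pi_quotg x.

Lemma quotg_projP x y :
  quotg_proj x = quotg_proj y <-> normal_closure A (x * y^-1).
Proof.
rewrite /quotg_proj; split=> [/eqquotP/asboolP //|Nxy].
by apply/eqquotP/asboolP.
Qed.

Lemma quotg_projK (u : quotg) : quotg_proj (repr u) = u.
Proof. exact: reprK. Qed.

Definition quotg_one : quotg := quotg_proj 1.
Definition quotg_mul (u v : quotg) : quotg := quotg_proj (repr u * repr v).
Definition quotg_inv (u : quotg) : quotg := quotg_proj (repr u)^-1.

Lemma quotg_mulE x y :
  quotg_mul (quotg_proj x) (quotg_proj y) = quotg_proj (x * y).
Proof.
have /quotg_projP Nx := quotg_projK (quotg_proj x).
have /quotg_projP Ny := quotg_projK (quotg_proj y).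
apply/quotg_projP; set a := repr _ in Nx *; set b := repr _ in Ny *.
have -> : a * b * (x * y)^-1 = (a * x^-1) * (b * y^-1) ^ x^-1.
  by rewrite conjgE invgM invgK !mulgA mulgVK.
exact: is_subgroupM sN Nx (normal_closureJ _ Ny).
Qed.

Lemma quotg_invE x : quotg_inv (quotg_proj x) = quotg_proj x^-1.
Proof.
have /quotg_projP Nx := quotg_projK (quotg_proj x).
apply/quotg_projP; set a := repr _ in Nx *.
have -> : a^-1 * x^-1^-1 = ((a * x^-1) ^ x)^-1.
  by rewrite conjgE mulgVK invgM.
exact: is_subgroupV sN (normal_closureJ _ Nx).
Qed.

Lemma quotg_mulA : associative quotg_mul.
Proof.
move=> u v w; rewrite -[u]quotg_projK -[v]quotg_projK -[w]quotg_projK.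
by rewrite !quotg_mulE mulgA.
Qed.

Lemma quotg_mul1 : left_id quotg_one quotg_mul.
Proof. by move=> u; rewrite -[u]quotg_projK quotg_mulE mul1g. Qed.

Lemma quotg_1mul : right_id quotg_one quotg_mul.
Proof. by move=> u; rewrite -[u]quotg_projK quotg_mulE mulg1. Qed.

Lemma quotg_mulV : left_inverse quotg_one quotg_inv quotg_mul.
Proof. by move=> u; rewrite -[u]quotg_projK quotg_invE quotg_mulE mulVg. Qed.

Lemma quotg_Vmul : right_inverse quotg_one quotg_inv quotg_mul.
Proof. by move=> u; rewrite -[u]quotg_projK quotg_invE quotg_mulE mulgV. Qed.

HB.instance Definition _ := isGroup.Build quotg
  quotg_mulA quotg_mul1 quotg_1mul quotg_mulV quotg_Vmul.

Lemma quotg_projM : {morph quotg_proj : x y / x * y}.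
Proof. by move=> x y; rewrite -quotg_mulE. Qed.

HB.instance Definition _ := isMultiplicative.Build G quotg quotg_proj quotg_projM.

End QuotientGroup.

Lemma gmorph1 (G K : groupType) (f : {multiplicative G -> K}) : f 1 = 1.
Proof. by apply: (mulgI (f 1)); rewrite -gmulfM !mulg1. Qed.

Lemma gmorphV (G K : groupType) (f : {multiplicative G -> K}) x :
  f x^-1 = (f x)^-1.
Proof. by apply: (mulgI (f x)); rewrite -gmulfM !mulgV gmorph1. Qed.

Lemma gmorphR (G K : groupType) (f : {multiplicative G -> K}) x y :
  f [~ x, y] = [~ f x, f y].
Proof. by rewrite commgEl conjgE !gmulfM !gmorphV. Qed.

Lemma gmorphJ (G K : groupType) (f : {multiplicative G -> K}) x y :
  f (x ^ y) = f x ^ f y.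
Proof. by rewrite conjgE !gmulfM gmorphV. Qed.

Lemma quotg_proj_eq1 (G : groupType) (A : set G) x :
  quotg_proj A x = 1 <-> normal_closure A x.
Proof. by rewrite -(gmorph1 (quotg_proj A)) quotg_projP invg1 mulg1. Qed.

Lemma quotg_proj_rel (G : groupType) (A : set G) x : A x -> quotg_proj A x = 1.
Proof.
move=> Ax; apply/quotg_proj_eq1; apply: sub_generated.
by exists x => //; exists 1; rewrite conjg1.
Qed.

Lemma quotg_lift (G K : groupType) (A : set G) (f : {multiplicative G -> K}) :
    (forall a, A a -> f a = 1) ->
  exists g : {multiplicative quotg A -> K},
    forall x, g (quotg_proj A x) = f x.
Proof.
move=> fA; have fN x : normal_closure A x -> f x = 1.
  apply: (generated_min (kernel_subgroup f)).
  by move=> _ [a Aa [g ->]]; rewrite /kernel /= gmorphJ fA ?conj1g.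
pose g (u : quotg A) := f (repr u).
have gE x : g (quotg_proj A x) = f x.
  have /quotg_projP/fN := quotg_projK (quotg_proj A x).
  by rewrite gmulfM gmorphV => /divg1_eq.
have gM : {morph g : u v / u * v}.
  move=> u v; rewrite -[u]quotg_projK -[v]quotg_projK -gmulfM !gE.
  exact: gmulfM.
by exists (HB.pack_for {multiplicative quotg A -> K} g
  (isMultiplicative.Build _ _ g gM)).
Qed.

(* The letter (x, true) stands for the generator x, (x, false) for x^-1.      *)
Inductive word_eq (X : Type) : seq (X * bool) -> seq (X * bool) -> Prop :=
| WordRefl u : word_eq u u
| WordSym u v : word_eq u v -> word_eq v u
| WordTrans v u w : word_eq u v -> word_eq v w -> word_eq u w
| WordCancel u x b v : word_eq (u ++ (x, b) :: (x, ~~ b) :: v) (u ++ v).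

Section FreeGroup.
Variable X : choiceType.
Local Notation word := (seq (X * bool)).
Implicit Types u v w : word.

Definition word_rel u v : bool := `[< word_eq u v >].

Lemma word_rel_refl : reflexive word_rel.
Proof. by move=> u; apply/asboolP; exact: WordRefl. Qed.

Lemma word_rel_sym : symmetric word_rel.
Proof.
by move=> u v; apply/asboolP/asboolP; exact: WordSym.
Qed.

Lemma word_rel_trans : transitive word_rel.
Proof.
by move=> v u w /asboolP uv /asboolP vw; apply/asboolP; exact: WordTrans uv vw.
Qed.

Canonical word_equiv : equiv_rel word :=
  EquivRel word_rel word_rel_refl word_rel_sym word_rel_trans.

Definition free_group := {eq_quot word_rel}.
HB.instance Definition _ := Choice.on free_group.
HB.instance Definition _ := EqQuotient.on free_group.

Definition word_inv u : word := rev [seq (l.1, ~~ l.2) | l <- u].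

Definition free_class u : free_group := \pi_free_group u.
Definition free_one : free_group := free_class [::].
Definition free_mul (a b : free_group) : free_group :=
  free_class (repr a ++ repr b).
Definition free_inv (a : free_group) : free_group :=
  free_class (word_inv (repr a)).

Definition free_gen (x : X) : free_group := free_class [:: (x, true)].

Lemma free_classP u v : free_class u = free_class v <-> word_eq u v.
Proof.
rewrite /free_class; split=> [/eqquotP/asboolP //|uv].
by apply/eqquotP/asboolP.
Qed.

Lemma free_classK (a : free_group) : free_class (repr a) = a.
Proof. exact: reprK. Qed.

Lemma word_eq_catl w u v : word_eq u v -> word_eq (w ++ u) (w ++ v).
Proof.
elim=> {u v} [u|u v _ IH|v u t _ IH1 _ IH2|u x b v].
- exact: WordRefl.
- exact: WordSym.
- exact: WordTrans IH1 IH2.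
- by rewrite !catA; exact: WordCancel.
Qed.

Lemma word_eq_catr w u v : word_eq u v -> word_eq (u ++ w) (v ++ w).
Proof.
elim=> {u v} [u|u v _ IH|v u t _ IH1 _ IH2|u x b v].
- exact: WordRefl.
- exact: WordSym.
- exact: WordTrans IH1 IH2.
- by rewrite -!catA; exact: WordCancel.
Qed.

Lemma word_eq_inv u v : word_eq u v -> word_eq (word_inv u) (word_inv v).
Proof.
elim=> {u v} [u|u v _ IH|v u t _ IH1 _ IH2|u x b v].
- exact: WordRefl.
- exact: WordSym.
- exact: WordTrans IH1 IH2.
- rewrite /word_inv !map_cat /= !rev_cat !rev_cons -!cats1 -!catA /=.
  by have := WordCancel (word_inv v) x (~~ (~~ b)) (word_inv u); rewrite !negbK.
Qed.

Lemma free_mulE u v : free_mul (free_class u) (free_class v) = free_class (u ++ v).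
Proof.
have /free_classP eu := free_classK (free_class u).
have /free_classP ev := free_classK (free_class v).
apply/free_classP.
by apply: WordTrans (word_eq_catl _ ev); apply: word_eq_catr.
Qed.

Lemma free_invE u : free_inv (free_class u) = free_class (word_inv u).
Proof.
have /free_classP eu := free_classK (free_class u).
by apply/free_classP/word_eq_inv.
Qed.

Lemma word_invK : involutive word_inv.
Proof.
move=> u; rewrite /word_inv map_rev revK -map_comp -[RHS]map_id.
by apply: eq_map => -[x b] /=; rewrite negbK.
Qed.

Lemma word_mulV u : word_eq (u ++ word_inv u) [::].
Proof.
elim/last_ind: u => [|u [x b] IH]; first exact: WordRefl.
rewrite /word_inv map_rcons rev_rcons cat_rcons /=.
by apply: WordTrans IH; exact: WordCancel.
Qed.

Lemma free_mulA : associative free_mul.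
Proof.
move=> a b c; rewrite -[a]free_classK -[b]free_classK -[c]free_classK.
by rewrite !free_mulE catA.
Qed.

Lemma free_mul1 : left_id free_one free_mul.
Proof. by move=> a; rewrite -[a]free_classK free_mulE. Qed.

Lemma free_1mul : right_id free_one free_mul.
Proof. by move=> a; rewrite -[a]free_classK free_mulE cats0. Qed.

Lemma free_Vmul : right_inverse free_one free_inv free_mul.
Proof.
move=> a; rewrite -[a]free_classK free_invE free_mulE.
by apply/free_classP; exact: word_mulV.
Qed.

Lemma free_mulV : left_inverse free_one free_inv free_mul.
Proof.
move=> a; rewrite -[a]free_classK free_invE free_mulE.
by apply/free_classP; rewrite -{2}[repr a]word_invK; exact: word_mulV.
Qed.

HB.instance Definition _ := isGroup.Build free_group
  free_mulA free_mul1 free_1mul free_mulV free_Vmul.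

End FreeGroup.

Lemma free_lift (X : choiceType) (K : groupType) (f : X -> K) :
  exists g : {multiplicative free_group X -> K}, forall x, g (free_gen x) = f x.
Proof.
pose val (l : X * bool) := if l.2 then f l.1 else (f l.1)^-1.
pose ev (u : seq (X * bool)) := foldr (fun l k => val l * k) 1 u.
have ev_cat u v : ev (u ++ v) = ev u * ev v.
  by elim: u => [|l u IH] /=; rewrite ?mul1g // IH mulgA.
have evE u v : word_eq u v -> ev u = ev v.
  elim=> {u v} // [u v w _ -> _ -> //|u x b v].
  rewrite !ev_cat /=; congr (_ * _); rewrite mulgA.
  by case: b; rewrite /val /= ?mulgV ?mulVg mul1g.
pose g (a : free_group X) := ev (repr a).
have gE u : g (free_class u) = ev u.
  by apply: evE; apply/free_classP; exact: free_classK.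
have gM : {morph g : a b / a * b}.
  move=> a b; rewrite -[a]free_classK -[b]free_classK.
  by rewrite -[_ * _]/(free_mul _ _) free_mulE !gE ev_cat.
exists (HB.pack_for {multiplicative free_group X -> K} g
  (isMultiplicative.Build _ _ g gM)) => x /=.
by rewrite gE /= mulg1.
Qed.

Lemma free_ind (X : choiceType) (P : free_group X -> Prop) :
    P 1 -> (forall x a, P a -> P (free_gen x * a)) ->
    (forall x a, P a -> P ((free_gen x)^-1 * a)) ->
  forall a, P a.
Proof.
move=> P1 Pg PV a; rewrite -[a]free_classK; elim: (repr a) => // -[x b] u IH.
rewrite -cat1s -free_mulE; case: b; first exact: Pg.
suff <- : (free_gen x)^-1 = free_class [:: (x, false)] by exact: PV.
exact: free_invE.
Qed.

Section Tensor.
Variables A B : groupType.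
Local Notation F := (free_group (A * B)%type).

Definition tensor_relators : set F :=
  [set u | [\/ exists a a' b,
                 u = free_gen (a, b) * free_gen (a', b) * (free_gen (a * a', b))^-1,
               exists a b b',
                 u = free_gen (a, b) * free_gen (a, b') * (free_gen (a, b * b'))^-1
             | exists c c', u = [~ free_gen c, free_gen c']]].

Definition tensor := quotg tensor_relators.
HB.instance Definition _ := Group.on tensor.

Definition tens (a : A) (b : B) : tensor :=
  quotg_proj tensor_relators (free_gen (a, b)).

End Tensor.

Section TensorTheory.
Variables A B : groupType.
Implicit Types (a : A) (b : B) (t u : tensor A B).

Lemma tensMl a a' b : tens (a * a') b = tens a b * tens a' b.
Proof.
have : quotg_proj (@tensor_relators A B) (free_gen (a, b) * free_gen (a', b) * (free_gen (a * a', b))^-1) = 1.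
  by apply: quotg_proj_rel; apply: Or31; exists a, a', b.
by rewrite !gmulfM gmorphV => /divg1_eq/esym.
Qed.

Lemma tensMr a b b' : tens a (b * b') = tens a b * tens a b'.
Proof.
have : quotg_proj (@tensor_relators A B) (free_gen (a, b) * free_gen (a, b') * (free_gen (a, b * b'))^-1) = 1.
  by apply: quotg_proj_rel; apply: Or32; exists a, b, b'.
by rewrite !gmulfM gmorphV => /divg1_eq/esym.
Qed.

Lemma tens1l b : tens 1 b = 1 :> tensor A B.
Proof. by apply: (mulgI (tens 1 b)); rewrite -tensMl !mulg1. Qed.

Lemma tens1r a : tens a 1 = 1 :> tensor A B.
Proof. by apply: (mulgI (tens a 1)); rewrite -tensMr !mulg1. Qed.

Lemma tensor_ind (P : tensor A B -> Prop) :
    P 1 -> (forall a b t, P t -> P (tens a b * t)) ->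
    (forall a b t, P t -> P ((tens a b)^-1 * t)) ->
  forall t, P t.
Proof.
move=> P1 Pg PV t; rewrite -[t]quotg_projK; elim/free_ind: (repr t).
- by rewrite gmorph1.
- by move=> [a b] w Pw; rewrite gmulfM; apply: Pg.
- by move=> [a b] w Pw; rewrite gmulfM gmorphV; apply: PV.
Qed.

Lemma tens_commute a b a' b' : commute (tens a b) (tens a' b').
Proof.
have : quotg_proj (@tensor_relators A B)
    [~ free_gen (a, b), free_gen (a', b')] = 1.
  by apply: quotg_proj_rel; apply: Or33; exists (a, b), (a', b').
by rewrite gmorphR => /eqP/commgP.
Qed.

Lemma tensor_commute t u : commute t u.
Proof.
have tC a b w : commute w (tens a b).
  elim/tensor_ind: w => [|a' b' w wC|a' b' w wC]; apply/commute_sym.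
  - exact: commute1.
  - by apply: commuteM; [exact: tens_commute | exact/commute_sym].
  - by apply: commuteM; [exact/commuteV/tens_commute | exact/commute_sym].
elim/tensor_ind: u => [|a b u uC|a b u uC]; first exact: commute1.
- by apply: commuteM.
- by apply: commuteM => //; apply: commuteV.
Qed.

Lemma tensor_lift (K : groupType) (f : A -> B -> K) :
    (forall a a' b, f (a * a') b = f a b * f a' b) ->
    (forall a b b', f a (b * b') = f a b * f a b') ->
    (forall a b a' b', commute (f a b) (f a' b')) ->
  exists g : {multiplicative tensor A B -> K}, forall a b, g (tens a b) = f a b.
Proof.
move=> fMl fMr fC; have [h hE] := free_lift (fun c : A * B => f c.1 c.2).
have h1 w : tensor_relators w -> h w = 1.
  case=> [[a [a' [b ->]]]|[a [b [b' ->]]]|[c [c' ->]]].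
  - by rewrite !gmulfM gmorphV !hE /= fMl mulgV.
  - by rewrite !gmulfM gmorphV !hE /= fMr mulgV.
  - by rewrite gmorphR !hE /=; apply/eqP/commgP/fC.
have [g gE] := quotg_lift h1.
by exists g => a b; rewrite gE hE.
Qed.

End TensorTheory.

Definition whole (H : finGroupType) : {group H} := [set: H]%G.
Definition derived (H : finGroupType) : {group H} := ((whole H)^`(1))%G.
Definition derived_center (H : finGroupType) : {group H} :=
  (derived H <*> 'Z(whole H))%G.

Definition special_pgroup (p : nat) (H : finGroupType) : Prop :=
  [/\ p.-group (whole H), ~~ abelian (whole H), special (whole H)
    & p.-abelem (derived H)].

Section SchurMultiplier.
Variables (X : choiceType) (H : finGroupType).
Variable phi : {multiplicative free_group X -> H}.

Definition RF : set (free_group X) := commutators (kernel phi) setT.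

Definition schur_multiplier : set (quotg RF) :=
  quotg_proj RF @` (kernel phi `&` commutators setT setT).

Definition is_beta
    (b : tensor (subg_of (derived H)) (coset_of (derived H)) -> quotg RF) : Prop :=
  (forall t u, b (t * u) = b t * b u) /\
  forall x z : free_group X, phi x \in derived H ->
    b (tens (subg (derived H) (phi x)) (coset (derived H) (phi z)))
      = quotg_proj RF [~ x, z].

(* The homomorphism characterized by is_beta; lemma betaP shows that it       *)
(* exists when phi is onto and H has class at most two.                       *)
Definition beta := xget (fun=> 1) [set b | is_beta b].

End SchurMultiplier.

Arguments schur_multiplier {X H} phi.
Arguments is_beta {X H} phi b.
Arguments beta {X H} phi.

Section Psi2.
Variable H : finGroupType.
Local Notation H' := (derived H).
Local Notation D := (coset_of (derived_center H)).

Definition is_Psi2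
    (f : tensor (tensor D D) D -> tensor (subg_of H') (coset_of H')) : Prop :=
  (forall t u, f (t * u) = f t * f u) /\
  forall x y z : H,
    f (tens (tens (coset (derived_center H) x) (coset (derived_center H) y))
            (coset (derived_center H) z))
      = tens (subg H' [~ x, y]) (coset H' z)
        * tens (subg H' [~ z, x]) (coset H' y)
        * tens (subg H' [~ y, z]) (coset H' x).

(* The homomorphism characterized by is_Psi2; lemma Psi2P shows that it       *)
(* exists when 'Z(H) = H'.                                                    *)
Definition Psi2 := xget (fun=> 1) [set f | is_Psi2 f].

(* In a special p-group w ^+ p lies in H', so subg does not truncate it.      *)
Definition power_tensors (p : nat) :
    set (tensor (subg_of H') (coset_of H')) :=
  generated [set t | exists w : H, t = tens (subg H' (w ^+ p)) (coset H' w)].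

(* Both sets are finite subgroups of exponent dividing p, so %/ is exact and  *)
(* logn p is the logarithm in base p.                                         *)
Definition mprime (p : nat) : nat :=
  logn p (#|` fset_set (power_tensors p)|
          %/ #|` fset_set (range Psi2 `&` power_tensors p)|).

End Psi2.

Arguments Psi2 : clear implicits.
Arguments power_tensors : clear implicits.
Arguments mprime : clear implicits.

Definition class2_relators (p d : nat) : set (free_group 'I_d) :=
  [set u | [\/ exists t, u = free_gen t ^+ p,
               exists i j, u = [~ free_gen i, free_gen j] ^+ p
             | exists i j t, u = [~ free_gen i, free_gen j, free_gen t]]].

Arguments class2_relators : clear implicits.

Lemma free_presentation (H : finGroupType) :
  exists (phi : {multiplicative free_group H -> H}), forall h, exists x, phi x = h.
Proof.
have [g gE] := free_lift (id : H -> H).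
by exists g => h; exists (free_gen h); rewrite gE.
Qed.

Section CentralCommutators.
Variable G : groupType.
Implicit Types a b c z : G.

Lemma conj_central z c : (forall g, commute z g) -> z ^ c = z.
Proof. by move=> zC; rewrite conjgE (zC c) mulKg. Qed.

Lemma commMl_central a b c : (forall g, commute [~ a, c] g) ->
  [~ a * b, c] = [~ a, c] * [~ b, c].
Proof.
move=> zC; have -> : [~ a * b, c] = [~ a, c] ^ b * [~ b, c].
  by rewrite !commgEl !conjgE !invgM !mulgA !mulgK.
by rewrite conj_central.
Qed.

Lemma commMr_central a b c : (forall g, commute [~ a, b] g) ->
  [~ a, b * c] = [~ a, b] * [~ a, c].
Proof.
move=> zC; have -> : [~ a, b * c] = [~ a, c] * [~ a, b] ^ c.
  by rewrite !commgEl !conjgE !invgM !mulgA !mulgK.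
by rewrite conj_central // -(zC [~ a, c]).
Qed.

Lemma comm_central_mul a b z z' :
    (forall g, commute z g) -> (forall g, commute z' g) ->
  [~ a * z, b * z'] = [~ a, b].
Proof.
move=> zC z'C.
have R1 g (y : G) : (forall g, commute y g) -> [~ g, y] = 1.
  by move=> yC; apply/eqP/commgP/commute_sym/yC.
have L1 g (y : G) : (forall g, commute y g) -> [~ y, g] = 1.
  by move=> yC; apply/eqP/commgP/yC.
have one_central (g : G) : commute 1 g by apply/commute_sym/commute1.
rewrite [a * z](commute_sym (zC a)) commMl_central L1 // mul1g.
by rewrite -(z'C b) commMr_central R1 // mul1g.
Qed.

End CentralCommutators.

Section BetaExists.
Variables (X : choiceType) (H : finGroupType).
Variable phi : {multiplicative free_group X -> H}.
Hypothesis phi_onto : forall h, exists x, phi x = h.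
Hypothesis class2 : derived H \subset 'Z(whole H).

Local Notation q := (quotg_proj (RF phi)).
Local Notation H' := (derived H).

Let q_central r : phi r = 1 -> forall e, commute (q r) e.
Proof.
move=> r1 e; rewrite -[e]quotg_projK; apply/commgP/eqP; rewrite -gmorphR.
apply: quotg_proj_rel; apply: sub_generated.
by exists r => //; exists (repr e).
Qed.

Let H'_comm g h : g \in H' -> [~ g, h] = 1.
Proof.
move=> /(fintype.subsetP class2)/centerP[_ /(_ h)] gC.
by apply/eqP/commgP/gC; rewrite finset.in_setT.
Qed.

Let q_comm_central x z : phi x \in H' -> forall e, commute [~ q x, q z] e.
Proof.
by move=> xH'; rewrite -gmorphR; apply: q_central; rewrite gmorphR H'_comm.
Qed.

Let q_comm_central' x z : phi x \in H' -> forall e, commute [~ q z, q x] e.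
Proof.
move=> xH' e; rewrite -invgR; apply/commute_sym/commuteV/commute_sym.
exact: q_comm_central.
Qed.

Let q_split x y : phi x = phi y -> q x = q y * q (y^-1 * x).
Proof. by rewrite -gmulfM mulgA mulgV mul1g. Qed.

Let q_splitC x y : phi x = phi y -> forall e, commute (q (y^-1 * x)) e.
Proof. by move=> xy; apply: q_central; rewrite gmulfM gmorphV xy mulVg. Qed.

Let q_derived_comm x w :
  phi x \in H' -> phi w \in H' -> commute (q x) (q w).
Proof.
move=> xH' wH'.
pose K := [set h : H | `[< forall y, phi y = h -> commute (q y) (q w) >]]%SET.
have gK : group_set K.
  apply/group_setP; split=> [|g h].
    by rewrite inE; apply/asboolP => y y1; apply: q_central.
  rewrite !inE => /asboolP Kg /asboolP Kh; apply/asboolP => y ygh.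
  have [g' g'E] := phi_onto g.
  rewrite -[y](mulVKg g') gmulfM; apply/commute_sym/commuteM.
    exact/commute_sym/Kg.
  by apply/commute_sym/Kh; rewrite gmulfM gmorphV g'E ygh mulKg.
suff /fintype.subsetP/(_ _ xH') : H' \subset Group gK.
  by rewrite inE => /asboolP; apply.
rewrite gen_subG; apply/fintype.subsetP => _ /imset2P[g h _ _ ->].
rewrite inE; apply/asboolP => y yE.
have [g' g'E] := phi_onto g; have [h' h'E] := phi_onto h.
have yR : phi y = phi [~ g', h'] by rewrite gmorphR g'E h'E.
rewrite (q_split yR); apply/commute_sym/commuteM; last first.
  exact/commute_sym/q_splitC.
apply/commute_sym/commgP; rewrite -conjg_fix gmorphR conjRg.
have conjM a b : a ^ b = a * [~ a, b] :> quotg (RF phi) by rewrite mulVKg.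
by rewrite !conjM comm_central_mul //; apply: q_comm_central'.
Qed.

Let q_comm_eq x x' z z' : phi x \in H' -> phi x = phi x' ->
    coset H' (phi z) = coset H' (phi z') ->
  q [~ x, z] = q [~ x', z'].
Proof.
move=> xH' xx' zz'; rewrite !gmorphR.
have x'H' : phi x' \in H' by rewrite -xx'.
have -> : [~ q x, q z] = [~ q x', q z].
  have := comm_central_mul (q x') (q z) (q_splitC xx')
    (fun g => commute_sym (commute1 g)).
  by rewrite mulg1 -q_split.
have wH' : phi (z'^-1 * z) \in H'.
  rewrite gmulfM gmorphV.
  have N h : h \in 'N(H')%g.
    by rewrite (fintype.subsetP (gFnorm _ (whole H))) // finset.in_setT.
  apply: coset_idr; first exact: N.
  by rewrite morphM ?morphV ?N ?groupV //= zz' mulVg.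
have -> : q z = q z' * q (z'^-1 * z) by rewrite -gmulfM mulVKg.
rewrite commMr_central; last exact: q_comm_central.
suff -> : [~ q x', q (z'^-1 * z)] = 1 by rewrite mulg1.
exact/eqP/commgP/q_derived_comm.
Qed.

Lemma betaP : is_beta phi (beta phi).
Proof.
have pre h : {x | phi x = h} by exact: cid.
have preE h : phi (sval (pre h)) = h by exact: svalP (pre h).
pose f (a : subg_of H') (c : coset_of H') :=
  q [~ sval (pre (sgval a)), sval (pre (fingroup.repr c))].
have fE x z : phi x \in H' -> f (subg H' (phi x)) (coset H' (phi z)) = q [~ x, z].
  move=> xH'; apply: q_comm_eq; rewrite preE ?subgK //.
  by rewrite coset_reprK.
have aE (a : subg_of H') : exists2 x, phi x \in H' & a = subg H' (phi x).
  exists (sval (pre (sgval a))); rewrite preE ?sgvalK //.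
  exact: subgP.
have cE (c : coset_of H') : exists z, c = coset H' (phi z).
  by exists (sval (pre (fingroup.repr c))); rewrite preE coset_reprK.
have N h : h \in 'N(H')%g.
  by rewrite (fintype.subsetP (gFnorm _ (whole H))) // finset.in_setT.
have fMl a a' c : f (a * a') c = f a c * f a' c.
  have [x xH' ->] := aE a; have [x' x'H' ->] := aE a'; have [z ->] := cE c.
  have xx'H' : phi (x * x') \in H' by rewrite gmulfM groupM.
  rewrite -subgM // -gmulfM !fE // !gmorphR gmulfM.
  exact: commMl_central (q_comm_central _ xH').
have fMr a c c' : f a (c * c') = f a c * f a c'.
  have [x xH' ->] := aE a; have [z ->] := cE c; have [z' ->] := cE c'.
  rewrite -morphM ?N // -gmulfM !fE // !gmorphR gmulfM.
  exact: commMr_central (q_comm_central _ xH').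
have fC a c a' c' : commute (f a c) (f a' c').
  have [x xH' ->] := aE a; have [z ->] := cE c.
  by rewrite fE // gmorphR; exact: (q_comm_central z xH').
have [g gE] := tensor_lift fMl fMr fC.
suff bg : is_beta phi g by apply: (xgetPex _ (ex_intro _ _ bg)).
by split=> [t u|x z xH']; [exact: gmulfM | rewrite gE fE].
Qed.

End BetaExists.

Section Psi2Exists.
Variable H : finGroupType.
Hypothesis centerE : 'Z(whole H) = derived H :> {set H}.

Local Notation H' := (derived H).
Local Notation N := (derived_center H).
Local Notation D := (coset_of N).
Local Notation T := (tensor (subg_of H') (coset_of H')).
Implicit Types x y z g h : H.

Let normT (A : {group H}) h : A <| whole H -> h \in 'N(A)%g.
Proof.
by move=> /normal_norm/fintype.subsetP -> //; rewrite finset.in_setT.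
Qed.

Let norm' h : h \in 'N(H')%g.
Proof. by apply: normT; exact: der_normal. Qed.

Let normN h : h \in 'N(N)%g.
Proof. by apply: normT; rewrite normalY ?der_normal ?center_normal. Qed.

Let NE : N = H' :> {set H}.
Proof. by rewrite /= centerE; apply/joing_idPl. Qed.

Let cosetM x y : coset H' (x * y) = coset H' x * coset H' y.
Proof. exact: (morphM (coset_morphism H') (norm' x) (norm' y)). Qed.

Let cosetNM x y : coset N (x * y) = coset N x * coset N y.
Proof. exact: (morphM (coset_morphism N) (normN x) (normN y)). Qed.

Let commH' x y : [~ x, y] \in H'.
Proof. by rewrite mem_commg ?finset.in_setT. Qed.

Let H'_central x : x \in H' -> forall g, commute x g.
Proof.
by rewrite -centerE => /centerP[_ xC] g; apply: xC; rewrite finset.in_setT.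
Qed.

Let form (x y z : H) : T :=
  tens (subg H' [~ x, y]) (coset H' z) * tens (subg H' [~ z, x]) (coset H' y)
  * tens (subg H' [~ y, z]) (coset H' x).

Let commMl x x' y : [~ x * x', y] = [~ x, y] * [~ x', y].
Proof. exact: commMl_central (H'_central (commH' _ _)). Qed.

Let commMr x y y' : [~ x, y * y'] = [~ x, y] * [~ x, y'].
Proof. exact: commMr_central (H'_central (commH' _ _)). Qed.

Let subgcM x y x' y' :
  subg H' ([~ x, y] * [~ x', y']) = subg H' [~ x, y] * subg H' [~ x', y'].
Proof. by rewrite subgM ?commH'. Qed.

Let mulTACA (a b c d : T) : (a * b) * (c * d) = (a * c) * (b * d).
Proof. by rewrite !mulgA -(mulgA a b c) (tensor_commute b c) !mulgA. Qed.

Let formC x y z : form x y z = form y z x.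
Proof.
exact: etrans (tensor_commute _ _) (mulgA _ _ _).
Qed.

Let formM1 x x' y z : form (x * x') y z = form x y z * form x' y z.
Proof.
rewrite /form commMl commMr !subgcM cosetM !tensMl tensMr.
by rewrite [RHS]mulTACA; congr (_ * _); exact: mulTACA.
Qed.

Let formM2 x y y' z : form x (y * y') z = form x y z * form x y' z.
Proof. by rewrite formC formM1 -[form y z x]formC -[form y' z x]formC. Qed.

Let formM3 x y z z' : form x y (z * z') = form x y z * form x y z'.
Proof. by rewrite -formC formM1 (formC z) (formC z'). Qed.

Let form1 x y z : x \in H' -> form x y z = 1.
Proof.
move=> xH'; have R1 g : [~ g, x] = 1.
  by apply/eqP/commgP/commute_sym/H'_central.
have L1 g : [~ x, g] = 1 by apply/eqP/commgP/H'_central.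
have subg1 : subg H' 1 = 1 by apply: val_inj; rewrite /= subgK ?group1.
by rewrite /form R1 L1 (coset_id xH') !subg1 !tens1l tens1r !mulg1.
Qed.

Let form_eq1 x x' y z : coset N x = coset N x' -> form x y z = form x' y z.
Proof.
move=> xx'; have wH' : x'^-1 * x \in H'.
  rewrite -NE; apply: coset_idr; first exact: normN.
  by rewrite morphM ?morphV ?normN ?groupV //= xx' mulVg.
by rewrite -[x in LHS](mulVKg x') formM1 (form1 _ _ wH') mulg1.
Qed.

Let form_eq x x' y y' z z' :
    coset N x = coset N x' -> coset N y = coset N y' -> coset N z = coset N z' ->
  form x y z = form x' y' z'.
Proof.
move=> xx' yy' zz'; rewrite (form_eq1 _ _ xx') formC (form_eq1 _ _ yy').
by rewrite formC (form_eq1 _ _ zz') formC.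
Qed.

Lemma Psi2P : is_Psi2 (Psi2 H).
Proof.
pose r (c : D) : H := fingroup.repr c.
have rE x : coset N (r (coset N x)) = coset N x by rewrite coset_reprK.
have rM c c' : coset N (r (c * c')) = coset N (r c * r c').
  by rewrite cosetNM !coset_reprK.
have g2 (c : D) : exists g : {multiplicative tensor D D -> T},
    forall a b, g (tens a b) = form (r a) (r b) (r c).
  apply: tensor_lift => [a a' b|a b b'|a b a' b']; last exact: tensor_commute.
    by rewrite -formM1; apply: form_eq.
  by rewrite -formM2; apply: form_eq.
pose g c := sval (cid (g2 c)).
have gE c a b : g c (tens a b) = form (r a) (r b) (r c).
  exact: (svalP (cid (g2 c))).
have gMl (t t' : tensor D D) (c : D) : g c (t * t') = g c t * g c t'.
  exact: gmulfM.
have gMr (t : tensor D D) (c c' : D) : g (c * c') t = g c t * g c' t.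
  elim/tensor_ind: t => [|a b t IH|a b t IH]; first by rewrite !gmorph1 mulg1.
    rewrite !gmulfM IH mulTACA !gE -formM3.
    by congr (_ * _); apply: form_eq.
  rewrite !gmulfM IH mulTACA !gmorphV !gE.
  congr (_ * _); rewrite (tensor_commute (_^-1)) -invgM -formM3.
  by congr (_^-1); apply: form_eq.
have [h hE] := tensor_lift (f := fun (t : tensor D D) (c : D) => g c t)
  gMl gMr (fun _ _ _ _ => tensor_commute _ _).
suff hP : is_Psi2 h by apply: (xgetPex _ (ex_intro _ _ hP)).
split=> [t u|x y z]; first exact: gmulfM.
by rewrite hE gE; apply: form_eq.
Qed.

End Psi2Exists.

(* Main.v *)
Require Import Defs.
From HB Require Import structures.
From mathcomp Require Import all_boot all_fingroup all_solvable all_algebra.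
From mathcomp Require Import generic_quotient.
From mathcomp Require Import finmap boolp classical_sets functions cardinality.
From mathcomp Require Import mxabelem ring zify.

Local Open Scope group_scope.
Local Open Scope classical_set_scope.

(** Let V = H / H', an F_p-space of dimension d, and T = H' (x) V.  Because H has
    the largest possible rank, the commutators [e i, e j], i < j, of d generators
    form a basis of H', so a homomorphism on H' may be prescribed on them.

    M(H) = Im beta: in F / [S, F], where S is the preimage of H', commutators are
    biadditive on V and killed by p, so they are determined by the commutators
    of H; hence R /\ F' lies in [S, F], whose image in M(H) is Im beta.

    ker beta = Im Psi2 . <w^p (x) w>: one inclusion is the Hall-Witt identity and
    [w^p, w] = 1.  For the other one, a functional l : T -> F_p vanishing on the
    right-hand side is detected on M(H) by a map from the free group of rank d to
    a Magnus-type group of nilpotency class 3 over Z / p^2.  Its degree 3 part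
    is one-dimensional; the product of degrees 1 and 2 realizes l on brackets
    [[e i, e j], e m] (possible because l kills the Jacobi elements Im Psi2), and a
    correction by a bilinear form in degree 1 realizes l on e i ^ p (x) e j
    (possible because l is alternating there).

    Im Psi2 has the basis Psi2 (e i, e j, e l), i < j < l, and T has order
    p^(d * 'C(d, 2)); the orders of kernel and image of beta follow.  In the
    coordinates of T the elements of Im Psi2 are totally antisymmetric, whereas
    e i ^ p (x) e i is supported on triples ending in i, so m' = 0 forces
    e i ^ p = 1. *)

Set Implicit Arguments.
Unset Strict Implicit.
Unset Printing Implicit Defensive.

(** * Elementary abelian groups *)

(** Generation is phrased through all subgroups given as predicates: it then serves directly as an
    induction principle, also in groups not known to be finite, such as tensor products and
    quotients of free groups. *)
Definition generates (G : groupType) (I : Type) (c : I -> G) : Prop :=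
  forall M : set G, is_subgroup M -> (forall i, M (c i)) -> forall x, M x.

Lemma is_subgroup_eq_hom (G K : groupType) (f g : {multiplicative G -> K}) :
  is_subgroup [set x | f x = g x].
Proof.
split=> [|x y /= fx fy]; first by rewrite /= !gmorph1.
by rewrite !gmulfM !gmorphV fx fy.
Qed.

Lemma eq_hom (G K : groupType) (I : Type) (c : I -> G)
    (f g : {multiplicative G -> K}) :
  generates c -> (forall i, f (c i) = g (c i)) -> forall x, f x = g x.
Proof. by move=> gen fg; apply: gen => //; apply: is_subgroup_eq_hom. Qed.

Lemma hom_inj (G K : groupType) (f : {multiplicative G -> K}) :
  (forall x, f x = 1 -> x = 1) -> injective f.
Proof.
by move=> f1 x y fxy; apply/divg1_eq/f1; rewrite gmulfM gmorphV fxy mulgV.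
Qed.

Lemma is_subgroup_image (G K : groupType) (f : {multiplicative G -> K}) (A : set G) :
  is_subgroup A -> is_subgroup (f @` A).
Proof.
move=> [A1 AF]; split=> [|_ _ [x Ax <-] [y Ay <-]].
  by exists 1; rewrite ?gmorph1.
by exists (x * y^-1); [apply: AF | rewrite gmulfM gmorphV].
Qed.

Lemma is_subgroup_preimage (G K : groupType) (f : {multiplicative G -> K}) (A : set K) :
  is_subgroup A -> is_subgroup (f @^-1` A).
Proof.
move=> [A1 AF]; split=> [|x y /= Ax Ay]; first by rewrite /= gmorph1.
by rewrite /= gmulfM gmorphV; apply: AF.
Qed.

Lemma generates_range (G K : groupType) (I : Type) (c : I -> G)
    (f : {multiplicative G -> K}) :
  generates c -> (forall y, exists x, f x = y) -> generates (f \o c).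
Proof.
move=> gen onto M sM Mc y; have [x <-] := onto y.
by apply: (gen _ (is_subgroup_preimage f sM)).
Qed.

Definition mult_hom (G K : groupType) (f : G -> K)
    (fM : forall x y, f (x * y) = f x * f y) : {multiplicative G -> K} :=
  HB.pack_for {multiplicative G -> K} f (isMultiplicative.Build _ _ f fM).

Section Elementary.
Variable (p n : nat).
Hypothesis p_pr : prime p.

Definition unit_vec (i : 'I_n) : elementary_abelian p n := delta_mx ord0 i.

Lemma generates_unit_vec : generates unit_vec.
Proof.
move=> M [M1 MF] Mc x; have sM : is_subgroup M by split.
rewrite [x]row_sum_delta; elim/big_rec: _ => // i y _ My.
apply: (is_subgroupM sM) => //.
rewrite -[x _ _]natr_Zp GRing.scaler_nat; elim: (x _ _ : nat) => [|k IH] //.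
by rewrite GRing.mulrS; apply: (is_subgroupM sM).
Qed.

Variable (G : groupType) (c : 'I_n -> G).
Hypothesis cC : forall i j, commute (c i) (c j).
Hypothesis cp : forall i, c i ^+ p = 1.

(* The coordinates of a vector are read as natural numbers below p. *)
Lemma elementary_hom : exists f : {multiplicative elementary_abelian p n -> G},
  forall i, f (unit_vec i) = c i.
Proof.
pose f (a : elementary_abelian p n) : G := \prod_(i < n) c i ^+ (a ord0 i : nat).
have fM a b : f (a * b) = f a * f b.
  rewrite /f -prodgM_commute; last first.
    by move=> i j _ _; exact: commuteX2 (cC _ _).
  apply: eq_bigr => i _; rewrite -expgnDr mxE /=.
  (* A coordinate of the sum is the remainder modulo p of the sum of the representatives; the
     discarded multiple of p contributes a power of [c i ^+ p], which is trivial. *)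
  set m := (_ + _)%N; rewrite [in RHS](divn_eq m (Zp_trunc (pdiv p)).+2).
  by rewrite expgnDr [in X in _ = X * _]Fp_cast // mulnC expgnA cp expg1n mul1g.
exists (mult_hom fM) => i /=; rewrite /f.
rewrite (eq_bigr (fun j => if j == i then c i else 1)) => [|j _].
  by rewrite -big_mkcond big_pred1_eq.
by rewrite mxE eqxx /= eq_sym; case: eqP => [<-|_] //=.
Qed.

Hypothesis gen : generates c.

(** The map [k] certifies that the generators [c i] are independent. The inverse comes from
    [elementary_hom], and both composites fix generators. *)
Lemma coordinates_bij (k : {multiplicative G -> elementary_abelian p n}) :
    (forall i, k (c i) = unit_vec i) ->
  exists f : {multiplicative elementary_abelian p n -> G},
    [/\ forall i, f (unit_vec i) = c i, cancel k f & cancel f k].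
Proof.
move=> kc; have [f fc] := elementary_hom; exists f; split=> //.
  by apply: (eq_hom (f := f \o k) (g := idfun) gen) => i /=; rewrite kc.
apply: (eq_hom (f := k \o f) (g := idfun) generates_unit_vec) => i /=.
by rewrite fc.
Qed.

End Elementary.

(** Here independence comes from counting: the homomorphism from F_p^n onto G is a surjection
    between sets of equal size, and its inverse gives the coordinates. *)
Lemma coordinates (p n : nat) (G : finGroupType) (c : 'I_n -> G) :
    prime p -> (forall i j, commute (c i) (c j)) -> (forall i, c i ^+ p = 1) ->
    generates c -> #|G| = (p ^ n)%N ->
  exists k : {multiplicative G -> elementary_abelian p n},
    forall i, k (c i) = unit_vec p i.
Proof.
move=> p_pr cC cp gen cardG; have [f fc] := elementary_hom p_pr cC cp.
have cardV : #|{: elementary_abelian p n}| = (p ^ n)%N.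
  by rewrite card_mx mul1n card_Fp.
have onto y : exists x, f x = y.
  suff [x _ <-] : range f y by exists x.
  apply: gen => [|i]; last by exists (unit_vec p i).
  by apply: is_subgroup_image; split.
pose g y := sval (cid (onto y)).
have gK : cancel g f by move=> y; exact: svalP (cid (onto y)).
have [h hK gh] : bijective g.
  by apply: inj_card_bij; [exact: can_inj gK | rewrite cardV cardG].
have fK : cancel f g by move=> u; rewrite -[u]gh gK.
have gM x y : g (x * y) = g x * g y by apply: (can_inj fK); rewrite gmulfM !gK.
by exists (mult_hom gM) => i /=; rewrite -fc fK.
Qed.

Lemma isomorphic_range (G K : groupType) (f : {multiplicative K -> G}) (A : set G) :
  injective f -> range f = A -> isomorphic A [set: K].
Proof.
(* The predicate [isomorphic] asks for a function on all of G; outside the range of [f] the partial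
   inverse takes the default value 1. *)
move=> inj <-; pose g x := xget 1 [set y | f y = x].
have fK : cancel f g.
  by move=> y; apply: inj; rewrite /g; case: xgetP => [z _ //|/(_ y)]; case.
exists g; split=> [_ _ [x _ <-] [y _ <-]|]; first by rewrite -gmulfM !fK.
split=> [x _ //|_ _ /set_mem[x _ <-] /set_mem[y _ <-]|y _]; first by rewrite !fK => ->.
by exists (f y); [exists y | rewrite fK].
Qed.

(** * Subgroups of F_p^n as row spaces *)

Section Subspaces.
Variables (p n : nat).
Hypothesis p_pr : prime p.
Local Notation E := 'rV['F_p]_n.

Definition finite_part (A : set E) : {set E} := [set x | `[< A x >]]%SET.

Lemma finite_part_group_set A : is_subgroup A -> group_set (finite_part A).
Proof.
move=> sA; apply/group_setP; split=> [|x y]; rewrite !finset.inE.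
  by apply/asboolP; case: sA.
by move=> /asboolP Ax /asboolP Ay; apply/asboolP; exact: is_subgroupM sA Ax Ay.
Qed.

Definition subspace_mx (A : set E) : 'M['F_p]_n := rowg_mx (finite_part A).

(** Over a prime field every additive subgroup is a subspace, hence the row space of a matrix; this
    makes ranks, complements and cokernels available. *)
Lemma subspace_mxP A x : is_subgroup A -> (x <= subspace_mx A)%MS = `[< A x >].
Proof.
move=> sA; rewrite -mem_rowg.
by rewrite (rowg_mxK (Group (finite_part_group_set sA))) finset.inE.
Qed.

Lemma card_finite_part A :
  is_subgroup A -> #|finite_part A| = (p ^ \rank (subspace_mx A))%N.
Proof.
move=> sA.
have AE : _ = finite_part A := rowg_mxK (Group (finite_part_group_set sA)).
by rewrite -{1}AE card_rowg card_Fp.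
Qed.

(** The cokernel matrix of A annihilates exactly A, so a nonzero coordinate of the product of [x]
    with it provides the functional. In ['F_p] taken as a group, [1] is the neutral element of
    addition, that is the scalar 0. *)
Lemma separating_functional A x : is_subgroup A -> ~ A x ->
  exists l : {multiplicative E -> 'F_p},
    (forall a, A a -> l a = 1) /\ l x <> 1.
Proof.
move=> sA nAx; pose C := cokermx (subspace_mx A).
have AE a : A a <-> (a *m C = 0)%R.
  by rewrite -(asboolE (A a)) -(subspace_mxP a sA) submxE; split=> [/eqP|/eqP].
have [j Cj] : exists j, (x *m C)%R ord0 j <> 0%R.
  apply/not_existsP => xC; apply: nAx; apply/AE/rowP => j.
  by rewrite [RHS]mxE; apply: contrapT; exact: xC.
pose l (a : E) : 'F_p := (a *m C)%R ord0 j.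
have functionalM a b : l (a * b) = l a * l b by rewrite /l mulmxDl mxE.
exists (mult_hom functionalM); split=> // a /AE aC.
by rewrite /= /l aC mxE.
Qed.

(** The kernel is a subspace of rank a, parametrized by a row basis; the range is the injective
    image of a complement, which has rank n - a. *)
Lemma isomorphic_kernel_range (G : groupType) (f : {multiplicative E -> G}) a :
    #|finite_part (kernel f)| = (p ^ a)%N ->
  isomorphic (kernel f) [set: elementary_abelian p a] /\
  isomorphic (range f) [set: elementary_abelian p (n - a)].
Proof.
have sK := kernel_subgroup f; set M := subspace_mx (kernel f).
rewrite card_finite_part // => /eqP; rewrite eqn_exp2l ?prime_gt1 // => /eqP ra.
have mxM m (C : 'M['F_p]_(m, n)) (u v : elementary_abelian p m) :
  (((u * v)%g *m C)%R : E) = ((u *m C)%R : E) * ((v *m C)%R : E).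
  exact: mulmxDl.
have mx_inj m (C : 'M['F_p]_(m, n)) : row_free C ->
    injective (fun u : elementary_abelian p m => (u *m C)%R : E).
  by move=> fC u v /(row_free_inj fC).
have fM u : (u <= M)%MS <-> f u = 1.
  by rewrite /M subspace_mxP //; split=> [/asboolP|fu]; last apply/asboolP.
split.
  have [C fC CM] : exists2 C : 'M['F_p]_(a, n), row_free C & (C :=: M)%MS.
    by rewrite -ra; exists (row_base M); [exact: row_base_free | exact: eq_row_base].
  apply: (isomorphic_range (f := mult_hom (mxM _ C))); first exact: mx_inj.
  apply/seteqP; split=> [_ [u _ <-]|x /= /fM]; first by apply/fM; rewrite /= -CM submxMl.
  by rewrite -CM => /submxP[u ->]; exists u.
have [C fC CM] : exists2 C : 'M['F_p]_(n - a, n), row_free C & (C :=: M^C)%MS.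
  rewrite -ra -mxrank_compl; exists (row_base M^C)%MS; first exact: row_base_free.
  exact: eq_row_base.
apply: (isomorphic_range (f := f \o mult_hom (mxM _ C))).
  apply: hom_inj => u /= /fM uM; apply: (mx_inj _ _ fC); rewrite mul0mx.
  by apply/eqP; rewrite -submx0 -(capmx_compl M) sub_capmx uM -CM submxMl.
apply/seteqP; split=> [_ [u _ <-]|_ [x _ <-]] /=; first by exists (u *m C)%R.
have : (x <= M + M^C)%MS by rewrite submx_full ?addsmx_compl_full.
case/sub_addsmxP=> -[u v] /= ->.
have /submxP[w vw] : ((v *m M^C)%R <= C)%MS by rewrite CM submxMl.
exists w => //=; rewrite -vw.
rewrite -[LHS]mul1g (_ : 1 = f (u *m M)%R) ?gmulfM //.
by apply/esym/fM; rewrite submxMl.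
Qed.

End Subspaces.

(** Preimages under the first isomorphism followed by the second one give an injection from F_p^m
    into F_p^n. *)
Lemma isomorphic_elementary_leq (p m n : nat) (G : groupType) (A : set G) :
    prime p -> isomorphic A [set: elementary_abelian p m] ->
  isomorphic A [set: elementary_abelian p n] -> (m <= n)%N.
Proof.
move=> p_pr [f [_ [_ _ f_surj]]] [g [_ [_ g_inj _]]].
have pre y : exists2 x, A x & f x = y by apply: f_surj.
pose h y := s2val (cid2 (pre y)).
have hA y : A (h y) by exact: s2valP (cid2 (pre y)).
have hK y : f (h y) = y by exact: s2valP' (cid2 (pre y)).
have inj : injective (fun y => g (h y)).
  by move=> y z /g_inj; rewrite !inE => /(_ (hA y) (hA z)) hyz; rewrite -[y]hK hyz hK.
have := leq_card _ inj; rewrite !card_mx !mul1n card_Fp //.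
by rewrite leq_exp2l ?prime_gt1.
Qed.

Lemma isomorphic_elementary_inj (p m n : nat) (G : groupType) (A : set G) :
    prime p -> isomorphic A [set: elementary_abelian p m] ->
  isomorphic A [set: elementary_abelian p n] -> m = n.
Proof.
move=> p_pr Am An; apply/eqP; rewrite eqn_leq.
by rewrite (isomorphic_elementary_leq p_pr Am An) (isomorphic_elementary_leq p_pr An Am).
Qed.

(** * A Magnus-type group of class three *)

Definition biadditive (U V W : zmodType) (f : U -> V -> W) : Prop :=
  (forall u u' v, f (u + u')%R v = (f u v + f u' v)%R) /\
  (forall u v v', f u (v + v')%R = (f u v + f u v')%R).

(* The augmentation ideal of an associative graded algebra, cut off after     *)
(* degree 3; md_shift perturbs the part of degree 3 of a product.             *)
Record magnus_data := MagnusData {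
  md1 : zmodType;
  md2 : zmodType;
  md3 : zmodType;
  md11 : md1 -> md1 -> md2;
  md12 : md1 -> md2 -> md3;
  md21 : md2 -> md1 -> md3;
  md_shift : md1 -> md1 -> md3;
  md11D : biadditive md11;
  md12D : biadditive md12;
  md21D : biadditive md21;
  md_shiftD : biadditive md_shift;
  mdA : forall u v w, md21 (md11 u v) w = md12 u (md11 v w)
}.

Section Biadditive.
Variables (U V W : zmodType) (f : U -> V -> W).
Hypothesis fD : biadditive f.
Local Open Scope ring_scope.

Lemma biaddDl u u' v : f (u + u') v = f u v + f u' v. Proof. by case: fD. Qed.
Lemma biaddDr u v v' : f u (v + v') = f u v + f u v'. Proof. by case: fD. Qed.

Lemma biadd0l v : f 0 v = 0.
Proof. by apply: (@GRing.addrI _ (f 0 v)); rewrite -biaddDl !GRing.addr0. Qed.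

Lemma biadd0r u : f u 0 = 0.
Proof. by apply: (@GRing.addrI _ (f u 0)); rewrite -biaddDr !GRing.addr0. Qed.

Lemma biaddNl u v : f (- u) v = - f u v.
Proof.
by apply: (@GRing.addrI _ (f u v)); rewrite -biaddDl !GRing.subrr biadd0l.
Qed.

Lemma biaddNr u v : f u (- v) = - f u v.
Proof.
by apply: (@GRing.addrI _ (f u v)); rewrite -biaddDr !GRing.subrr biadd0r.
Qed.

Lemma biaddMnl u v n : f (u *+ n) v = f u v *+ n.
Proof.
by elim: n => [|n IH]; rewrite ?biadd0l // !GRing.mulrS biaddDl IH.
Qed.

Lemma biaddMnr u v n : f u (v *+ n) = f u v *+ n.
Proof.
by elim: n => [|n IH]; rewrite ?biadd0r // !GRing.mulrS biaddDr IH.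
Qed.

Definition biaddE :=
  (biaddDl, biaddDr, biaddNl, biaddNr, biadd0l, biadd0r, biaddMnl, biaddMnr).

End Biadditive.

Section Magnus.
Variable D : magnus_data.
Local Open Scope ring_scope.

Definition magnus : Type := md1 D * md2 D * md3 D.
HB.instance Definition _ := Choice.on magnus.

Definition deg1 (x : magnus) : md1 D := x.1.1.
Definition deg2 (x : magnus) : md2 D := x.1.2.
Definition deg3 (x : magnus) : md3 D := x.2.

Definition magnus_one : magnus := (0, 0, 0).

(** A triple (a, b, c) stands for the unit 1 + a + b + c, and this is multiplication of units, with
    [md_shift] added in degree 3. Being biadditive, the shift is a 2-cocycle, so associativity
    survives. *)
Definition magnus_mul (x y : magnus) : magnus :=
  (deg1 x + deg1 y,
   deg2 x + deg2 y + md11 (deg1 x) (deg1 y),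
   deg3 x + deg3 y + (md_shift (deg1 x) (deg1 y)
     + (md12 (deg1 x) (deg2 y) + md21 (deg2 x) (deg1 y)))).

(** The geometric series 1 - x + x^2 - x^3 sorted by degree, with a term compensating the shift. *)
Definition magnus_inv (x : magnus) : magnus :=
  (- deg1 x,
   - deg2 x + md11 (deg1 x) (deg1 x),
   - deg3 x + (md_shift (deg1 x) (deg1 x)
     + (md12 (deg1 x) (deg2 x - md11 (deg1 x) (deg1 x))
        + md21 (deg2 x) (deg1 x)))).

Definition magnus_biaddE := (biaddE (md11D D), biaddE (md12D D),
  biaddE (md21D D), biaddE (md_shiftD D)).

Lemma magnus_mulA : associative magnus_mul.
Proof.
move=> [[a b] c] [[a' b'] c'] [[a'' b''] c''].
rewrite /magnus_mul /deg1 /deg2 /deg3 /= !magnus_biaddE mdA.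
congr (_, _, _); first exact: GRing.addrA.
  by rewrite !GRing.addrA [LHS](ACl (1*2*5*3*6*4)).
by rewrite !GRing.addrA [LHS](ACl (1*2*7*9*12*3*8*4*10*5*13*6*11)).
Qed.

Lemma magnus_mul1 : left_id (magnus_one : magnus) magnus_mul.
Proof.
move=> [[a b] c]; rewrite /magnus_mul /deg1 /deg2 /deg3 /= !magnus_biaddE.
by rewrite !GRing.addr0 !GRing.add0r.
Qed.

Lemma magnus_1mul : right_id (magnus_one : magnus) magnus_mul.
Proof.
move=> [[a b] c]; rewrite /magnus_mul /deg1 /deg2 /deg3 /= !magnus_biaddE.
by rewrite !GRing.addr0.
Qed.

Lemma magnus_mulV : left_inverse (magnus_one : magnus) magnus_inv magnus_mul.
Proof.
move=> [[a b] c]; rewrite /magnus_mul /magnus_inv /magnus_one /deg1 /deg2 /deg3 /=.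
rewrite !magnus_biaddE mdA !GRing.addNr.
congr (_, _, _).
  by rewrite [LHS](ACl ((1*3)*(2*4))) /= GRing.addNr GRing.addrN GRing.addr0.
rewrite !GRing.addrA [LHS](ACl ((1*6)*(2*7)*(3*8)*(4*10)*(5*9))) /=.
by rewrite !(GRing.addNr, GRing.addrN) !GRing.addr0.
Qed.

Lemma magnus_Vmul : right_inverse (magnus_one : magnus) magnus_inv magnus_mul.
Proof.
move=> [[a b] c]; rewrite /magnus_mul /magnus_inv /magnus_one /deg1 /deg2 /deg3 /=.
rewrite !magnus_biaddE !GRing.addrN.
congr (_, _, _).
  by rewrite GRing.addrA GRing.addrN GRing.add0r GRing.addrN.
rewrite !GRing.addrA [LHS](ACl ((1*2)*(3*7)*(4*8)*(5*9)*(6*10))) /=.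
by rewrite !(GRing.addNr, GRing.addrN) !GRing.addr0.
Qed.

HB.instance Definition _ := isGroup.Build magnus
  magnus_mulA magnus_mul1 magnus_1mul magnus_mulV magnus_Vmul.

Implicit Types x y z : magnus.

Lemma deg1M x y : deg1 (x * y)%g = deg1 x + deg1 y. Proof. by []. Qed.

Lemma deg2M x y : deg2 (x * y)%g = deg2 x + deg2 y + md11 (deg1 x) (deg1 y).
Proof. by []. Qed.

Lemma deg3M x y : deg3 (x * y)%g = deg3 x + deg3 y
  + (md_shift (deg1 x) (deg1 y)
     + (md12 (deg1 x) (deg2 y) + md21 (deg2 x) (deg1 y))).
Proof. by []. Qed.

Lemma deg1V x : deg1 x^-1%g = - deg1 x. Proof. by []. Qed.

Lemma deg1X x n : deg1 (x ^+ n)%g = deg1 x *+ n.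
Proof. by elim: n => // n IH; rewrite expgS deg1M IH GRing.mulrS. Qed.

Lemma deg2X x n :
  deg2 (x ^+ n)%g = deg2 x *+ n + md11 (deg1 x) (deg1 x) *+ 'C(n, 2).
Proof.
elim: n => [|n IH]; first by rewrite GRing.addr0.
rewrite expgS deg2M IH deg1X (biaddMnr (md11D D)) binS bin1 GRing.mulrnDr.
by rewrite GRing.mulrS !GRing.addrA.
Qed.

(** Comparing degrees in x y = y x [x, y] gives the parts of a commutator without expanding
    inverses; [deg2R] and [deg3R] follow the same pattern. *)
Lemma deg1R x y : deg1 [~ x, y]%g = 0.
Proof.
apply: (@GRing.addrI _ (deg1 y + deg1 x)).
by rewrite GRing.addr0 -!deg1M -commgC deg1M GRing.addrC.
Qed.

Lemma deg2R x y :
  deg2 [~ x, y]%g = md11 (deg1 x) (deg1 y) - md11 (deg1 y) (deg1 x).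
Proof.
apply: (@GRing.addrI _ (deg2 (y * x)%g)).
have := congr1 deg2 (commgC x y).
rewrite [RHS in _ = RHS -> _]deg2M deg1R (biadd0r (md11D D)) GRing.addr0 => <-.
rewrite !deg2M [deg2 x + _]GRing.addrC -[RHS]GRing.addrA.
by rewrite [md11 (deg1 y) _ + (_ - _)]GRing.addrC GRing.subrK.
Qed.

(** What remains of the degree 3 part of [x, y] once [deg1 x] is a multiple of p and p kills the
    products into degree 3; see [deg3R]. *)
Definition magnus_bracket x y : md3 D :=
  md_shift (deg1 x) (deg1 y) - md_shift (deg1 y) (deg1 x)
  + (md21 (deg2 x) (deg1 y) - md12 (deg1 y) (deg2 x)).

Section Exponent.
Variable p : nat.
Hypothesis md12p : forall u v, md12 u v *+ p = 0 :> md3 D.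
Hypothesis md21p : forall u v, md21 u v *+ p = 0 :> md3 D.
Hypothesis md_shiftp : forall u v, md_shift u v *+ p *+ p = 0 :> md3 D.

(** The condition met by the images of free group elements lying over H': p-th powers and
    commutators satisfy it, and it is stable under products and inverses. *)
Definition p_divisible x : Prop := exists u, deg1 x = u *+ p.

Lemma deg3R x y : p_divisible x -> deg3 [~ x, y]%g = magnus_bracket x y.
Proof.
move=> [u xu]; apply: (@GRing.addrI _ (deg3 (y * x)%g)).
have := congr1 deg3 (commgC x y).
(* The degree 2 part of [x, y] is a multiple of p because [deg1 x] is, so it contributes nothing to
   degree 3. *)
have left0 w : md12 w (deg2 [~ x, y]%g) = 0.
  rewrite deg2R xu !(biaddMnl (md11D D), biaddMnr (md11D D)) -GRing.mulrnBl.
  by rewrite (biaddMnr (md12D D)) md12p.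
rewrite [RHS in _ = RHS -> _]deg3M deg1R left0 (biadd0r (md21D D)).
rewrite (biadd0r (md_shiftD D)) !GRing.addr0 => <-.
rewrite !deg3M /magnus_bracket xu.
rewrite !(biaddMnl (md12D D), biaddMnr (md21D D)) md12p md21p.
rewrite !GRing.addr0 !GRing.add0r.
rewrite !GRing.addrA [deg3 y + _]GRing.addrC.
by rewrite [RHS](ACl (1*2*5*7*(3*6)*(4*8))) /= !GRing.addrN !GRing.addr0.
Qed.

(** On p-divisible elements the degree 3 part is a homomorphism: every correction term carries a
    factor p from the products or p^2 from the shift. *)
Lemma deg3M_divisible x y :
  p_divisible x -> p_divisible y -> deg3 (x * y)%g = deg3 x + deg3 y.
Proof.
move=> [u xu] [v yv]; rewrite deg3M xu yv !magnus_biaddE md_shiftp md12p md21p.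
by rewrite !GRing.addr0.
Qed.

Lemma magnus_bracketDl x y z : p_divisible x ->
  magnus_bracket (x * y)%g z = magnus_bracket x z + magnus_bracket y z.
Proof.
move=> [u xu]; rewrite /magnus_bracket deg1M deg2M !magnus_biaddE xu.
rewrite !(biaddMnl (md11D D), biaddMnl (md21D D), biaddMnr (md12D D)) md12p md21p.
rewrite !GRing.addr0 !GRing.opprD.
by rewrite !GRing.addrA [LHS](ACl (1*3*5*7*2*4*6*8)).
Qed.

Lemma p_divisibleM x y : p_divisible x -> p_divisible y -> p_divisible (x * y)%g.
Proof.
by move=> [u xu] [v yv]; exists (u + v); rewrite deg1M xu yv GRing.mulrnDl.
Qed.

Lemma p_divisibleV x : p_divisible x -> p_divisible x^-1%g.
Proof. by move=> [u xu]; exists (- u); rewrite deg1V xu GRing.mulNrn. Qed.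

Lemma p_divisibleX x : p_divisible (x ^+ p)%g.
Proof. by exists (deg1 x); rewrite deg1X. Qed.

Lemma p_divisibleR x y : p_divisible [~ x, y]%g.
Proof. by exists 0; rewrite deg1R GRing.mul0rn. Qed.

(** For odd p the binomial 'C(p, 2) is a multiple of p, so all of [deg2 (x ^+ p)] disappears. The
    shift is killed only by p^2, and its antisymmetrization survives with one factor p. *)
Lemma magnus_bracketX x y : odd p ->
  magnus_bracket (x ^+ p)%g y
    = (md_shift (deg1 x) (deg1 y) - md_shift (deg1 y) (deg1 x)) *+ p.
Proof.
move=> p_odd; rewrite /magnus_bracket deg1X deg2X !magnus_biaddE md12p md21p.
rewrite bin2odd // !GRing.mulrnA md12p md21p !GRing.mul0rn !GRing.addr0 GRing.subr0.
by rewrite GRing.mulrnBl GRing.addr0.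
Qed.

Lemma magnus_bracketR x y z : magnus_bracket [~ x, y]%g z =
  md21 (deg2 [~ x, y]%g) (deg1 z) - md12 (deg1 z) (deg2 [~ x, y]%g).
Proof.
by rewrite /magnus_bracket deg1R !magnus_biaddE GRing.subr0 GRing.add0r.
Qed.

End Exponent.

End Magnus.

(** * Special p-groups and their tensor product *)

Section DualFamily.
Variables (p : nat) (I : finType) (G : groupType) (c : I -> G).
Hypothesis p_pr : prime p.
Local Notation n := #|I|.
Local Notation E := (elementary_abelian p n).

Definition dual_family (k : I -> {multiplicative G -> 'F_p}) : Prop :=
  forall i j, k i (c j) = (i == j)%:R%R.

Lemma generates_enum_val : generates c -> generates (fun i : 'I_n => c (enum_val i)).
Proof.
move=> gen M sM Mc; apply: gen => // i.
by rewrite -(enum_rankK i); apply: Mc.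
Qed.

Lemma dual_family_coordinates (k : I -> {multiplicative G -> 'F_p}) :
    dual_family k ->
  exists g : {multiplicative G -> E},
    (forall i, g (c i) = unit_vec p (enum_rank i)) /\
    (forall x i, g x ord0 (enum_rank i) = k i x).
Proof.
move=> kc; pose g x : E := (\row_j k (enum_val j) x)%R.
have gM x y : g (x * y) = g x * g y by apply/rowP => j; rewrite !mxE gmulfM.
exists (mult_hom gM); split=> [i|x i]; last by rewrite mxE enum_rankK.
apply/rowP => j; rewrite !mxE kc eqxx /=.
by rewrite -(inj_eq enum_rank_inj) enum_valK eq_sym.
Qed.

Hypothesis cC : forall i j, commute (c i) (c j).
Hypothesis cp : forall i, c i ^+ p = 1.

Lemma dual_family_bij (k : I -> {multiplicative G -> 'F_p}) :
    generates c -> dual_family k ->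
  exists g : {multiplicative G -> E}, exists f : {multiplicative E -> G},
    [/\ forall i, g (c i) = unit_vec p (enum_rank i),
        forall x i, g x ord0 (enum_rank i) = k i x, cancel g f & cancel f g].
Proof.
move=> gen kc; have [g [gc gk]] := dual_family_coordinates kc.
have gcE (i : 'I_n) : g (c (enum_val i)) = unit_vec p i by rewrite gc enum_valK.
have [f [_ gf fg]] := coordinates_bij p_pr (fun i j => cC _ _) (fun i => cp (enum_val i))
  (generates_enum_val gen) gcE.
by exists g, f.
Qed.

End DualFamily.

(** For a finite group of the right order, generation already forces independence. For the tensor
    product, whose order is not known beforehand, dual functionals are instead built from those of
    the factors. *)
Lemma dual_family_exists (p : nat) (I : finType) (G : finGroupType) (c : I -> G) :
    prime p -> (forall i j, commute (c i) (c j)) -> (forall i, c i ^+ p = 1) ->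
    generates c -> #|G| = (p ^ #|I|)%N ->
  exists k : I -> {multiplicative G -> 'F_p}, dual_family c k.
Proof.
move=> p_pr cC cp gen cardG.
have [g gc] := coordinates p_pr (fun i j : 'I_#|I| => cC (enum_val i) (enum_val j))
  (fun i => cp _) (generates_enum_val gen) cardG.
pose k i (x : G) : 'F_p := g x ord0 (enum_rank i).
have kM i x y : k i (x * y) = k i x * k i y by rewrite /k gmulfM mxE.
exists (fun i => mult_hom (kM i)) => i j /=.
rewrite /k -{1}(enum_rankK j) gc mxE eqxx /=.
by rewrite (inj_eq enum_rank_inj).
Qed.

Section SpecialGroup.
Variables (p d : nat) (H : finGroupType).
Hypothesis p_pr : prime p.
Hypothesis specialH : special_pgroup p H.
Hypothesis rankH : 'm(whole H) = d.
Hypothesis card_derived : #|derived H| = (p ^ (d * (d - 1) %/ 2))%N.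
Local Notation H' := (derived H).

Implicit Types x y z : H.

Let pH : p.-group (whole H). Proof. by case: specialH. Qed.

Lemma special_centerE : 'Z(whole H) = H' :> {set H}.
Proof. by case: specialH => _ _ []. Qed.

Lemma special_class2 : H' \subset 'Z(whole H).
Proof. by rewrite special_centerE. Qed.

Lemma derived_central x : x \in H' -> forall g, commute x g.
Proof.
by rewrite -special_centerE => /centerP[_ xC] g; apply: xC; rewrite finset.in_setT.
Qed.

Lemma comm_derived x y : [~ x, y] \in H'.
Proof. by rewrite mem_commg ?finset.in_setT. Qed.

Lemma derived_exp x : x \in H' -> x ^+ p = 1.
Proof. by case: specialH => _ _ _ /(abelemP p_pr)[_]; apply. Qed.

Lemma norm_derived x : x \in 'N(H').
Proof.
by rewrite (fintype.subsetP (normal_norm (der_normal 1 _))) ?finset.in_setT.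
Qed.

Let PhiE : 'Phi(whole H) = H'.
Proof. by case: specialH => _ _ [-> <-]. Qed.

Lemma quotient_derived_abelem : p.-abelem (whole H / H').
Proof. by rewrite -PhiE Phi_quotient_abelem. Qed.

Lemma mem_quotient_derived (c : coset_of H') : c \in whole H / H'.
Proof. by rewrite -(coset_reprK c) mem_quotient ?finset.in_setT. Qed.

Lemma exp_derived x : x ^+ p \in H'.
Proof.
have [_ Q1] := abelemP p_pr quotient_derived_abelem.
apply: coset_idr; first exact: norm_derived.
by rewrite morphX ?norm_derived ?Q1 // mem_quotient ?finset.in_setT.
Qed.

Lemma generators_exist : exists e : 'I_d -> H, generates e.
Proof.
have [B genB cardB] := grank_witness (whole H).
have cB : #|B| = d by rewrite cardB.
exists (fun i => enum_val (cast_ord (esym cB) i)) => M sM Me x.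
have gM : group_set [set y | `[< M y >]]%SET.
  apply/group_setP; split=> [|y z]; rewrite !finset.inE.
    by apply/asboolP; case: sM.
  by move=> /asboolP My /asboolP Mz; apply/asboolP; exact: is_subgroupM sM My Mz.
have : <<B>> \subset Group gM.
  rewrite gen_subG; apply/fintype.subsetP => b Bb; rewrite finset.inE; apply/asboolP.
  have := Me (cast_ord cB (enum_rank_in Bb b)).
  by rewrite cast_ordK enum_rankK_in.
rewrite genB => /fintype.subsetP/(_ x).
by rewrite !finset.inE => /(_ isT)/asboolP.
Qed.

(** Burnside's basis theorem: H' is the Frattini subgroup, so lifts of generators of H / H' generate
    H. Hence H / H' needs d generators, and for an elementary abelian group this number is the
    dimension. *)
Lemma card_quotient_derived : #|whole H / H'| = (p ^ d)%N.
Proof.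
have abQ := quotient_derived_abelem.
have pQ := abelem_pgroup abQ.
have rQ : 'm(whole H / H') = logn p #|whole H / H'|.
  by rewrite grank_abelian ?(abelem_abelian abQ) // (rank_pgroup pQ) p_rank_abelem.
have -> : d = logn p #|whole H / H'|; last by rewrite -card_pgroup.
apply/eqP; rewrite -rQ -rankH eqn_leq quotient_grank ?andbT; last first.
  exact: normal_norm (der_normal 1 _).
have [B genB <-] := grank_witness (whole H / H').
pose r (b : coset_of H') := fingroup.repr b.
pose C := [set r b | b in B]%SET.
apply: (leq_trans _ (leq_imset_card r B)); rewrite -/C.
rewrite -(_ : <<C>> = whole H) ?grank_min //.
apply: Phi_nongen; rewrite PhiE.
apply/eqP; rewrite finset.eqEsubset finset.subsetT /=.
rewrite -(quotientSGK _ (joing_subl H' C)); last first.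
  exact: normal_norm (der_normal 1 _).
suff : <<B>> \subset (H' <*> C) / H' by rewrite genB.
rewrite gen_subG; apply/fintype.subsetP => b Bb.
rewrite -(coset_reprK b) mem_quotient //.
by rewrite (fintype.subsetP (joing_subr H' C)) //; apply/imsetP; exists b.
Qed.

Lemma special_commMl x x' y : [~ x * x', y] = [~ x, y] * [~ x', y].
Proof. exact: commMl_central (derived_central (comm_derived _ _)). Qed.

Lemma special_commMr x y y' : [~ x, y * y'] = [~ x, y] * [~ x, y'].
Proof. exact: commMr_central (derived_central (comm_derived _ _)). Qed.

(** The commutator as an element of the type of H', so that it can be a factor of a tensor. *)
Definition subcomm (x y : H) : subg_of H' := subg H' [~ x, y].

Lemma subcommMl x x' y : subcomm (x * x') y = subcomm x y * subcomm x' y.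
Proof. by rewrite /subcomm special_commMl subgM ?comm_derived. Qed.

Lemma subcommMr x y y' : subcomm x (y * y') = subcomm x y * subcomm x y'.
Proof. by rewrite /subcomm special_commMr subgM ?comm_derived. Qed.

Definition subcomml y : {multiplicative H -> subg_of H'} :=
  mult_hom (fun x x' => subcommMl x x' y).
Definition subcommr x : {multiplicative H -> subg_of H'} := mult_hom (subcommMr x).

Lemma subg_derived1 : subg H' 1 = 1.
Proof. by apply: val_inj; rewrite /= subgK ?group1. Qed.

Lemma subcommV x y : (subcomm x y)^-1 = subcomm y x.
Proof.
apply: (mulgI (subcomm x y)); rewrite mulgV /subcomm -subgM ?comm_derived //.
by rewrite -(invgR x y) mulgV subg_derived1.
Qed.

Lemma subcommxx x : subcomm x x = 1.
Proof. by rewrite /subcomm commgg subg_derived1. Qed.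

Lemma derived_ind (M : set (subg_of H')) :
    is_subgroup M -> (forall x y, M (subcomm x y)) -> forall h, M h.
Proof.
move=> sM Mc h; rewrite -[h]sgvalK.
have gM : group_set [set y | (y \in H') && `[< M (subg H' y) >]]%SET.
  apply/group_setP; split=> [|y z]; rewrite !finset.inE.
    by rewrite group1 subg_derived1; apply/asboolP; case: sM.
  move=> /andP[yH /asboolP My] /andP[zH /asboolP Mz]; rewrite groupM //=.
  by apply/asboolP; rewrite subgM //; exact: is_subgroupM.
have /fintype.subsetP/(_ _ (subgP h)) : H' \subset Group gM.
  rewrite gen_subG; apply/fintype.subsetP => _ /imset2P[x y _ _ ->].
  by rewrite finset.inE comm_derived; apply/asboolP; apply: Mc.
by rewrite finset.inE => /andP[_ /asboolP].
Qed.

Lemma generates_subcomm (e : 'I_d -> H) (M : set (subg_of H')) :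
    generates e -> is_subgroup M -> 
    (forall i j : 'I_d, (i < j)%N -> M (subcomm (e i) (e j))) -> forall h, M h.
Proof.
move=> gen sM Mc.
have Mc' i j : M (subcomm (e i) (e j)).
  case: (ltngtP i j) => [|ji|/val_inj->]; first exact: Mc.
    by rewrite -subcommV; apply: (is_subgroupV sM); apply: Mc.
  by rewrite subcommxx; case: sM.
apply: derived_ind => // x y.
apply: (gen _ (is_subgroup_preimage (subcomml y) sM)) => i /=.
exact: (gen _ (is_subgroup_preimage (subcommr (e i)) sM) (Mc' i)).
Qed.

Lemma commute_subg_derived (g h : subg_of H') : commute g h.
Proof. by apply: val_inj; exact: derived_central (subgP g) _. Qed.

Lemma subg_derived_exp (g : subg_of H') : g ^+ p = 1.
Proof.
apply: val_inj; rewrite -[RHS](derived_exp (subgP g)).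
by elim: p => // n IH; rewrite !expgS -IH.
Qed.

Lemma quotient_derived_exp (x : coset_of H') : x ^+ p = 1.
Proof.
have [_ Q1] := abelemP p_pr quotient_derived_abelem.
exact: Q1 (mem_quotient_derived x).
Qed.

Lemma commute_coset_derived (x y : coset_of H') : commute x y.
Proof.
have /centsP := abelem_abelian quotient_derived_abelem.
by apply; exact: mem_quotient_derived.
Qed.

Definition derived_coset : H -> coset_of H' := coset H'.

Lemma derived_cosetM x y : derived_coset (x * y) = derived_coset x * derived_coset y.
Proof. exact: morphM (norm_derived x) (norm_derived y). Qed.

Definition coset_hom : {multiplicative H -> coset_of H'} := mult_hom derived_cosetM.

Lemma coset_hom_onto c : exists x, coset_hom x = c.
Proof. by exists (fingroup.repr c); exact: coset_reprK. Qed.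

Lemma generates_coset (I : Type) (e : I -> H) :
  generates e -> generates (fun i => coset_hom (e i)).
Proof. by move=> gen; exact: generates_range gen coset_hom_onto. Qed.

Lemma coset_hom1 x : coset_hom x = 1 <-> x \in H'.
Proof.
split=> [/(coset_idr (norm_derived x)) //|xH']; exact: coset_id.
Qed.

Lemma card_coset_derived : #|{: coset_of H'}| = (p ^ d)%N.
Proof.
rewrite -card_quotient_derived; apply: eq_card => c.
by rewrite mem_quotient_derived.
Qed.

(** This is how the rank hypothesis is used: the order of H' matches the number of pairs i < j,
    which makes the generating commutators [e i, e j] a basis. *)
Lemma card_subg_derived : #|{: subg_of H'}| = (p ^ 'C(d, 2))%N.
Proof.
by rewrite card_sub bin2 -divn2 -subn1 -card_derived; apply: eq_card => x; rewrite !inE.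
Qed.

End SpecialGroup.

(** * Increasing pairs and triples of indices *)

Definition pairs (d : nat) := {x : 'I_d * 'I_d | (x.1 < x.2)%N}.

Lemma card_pairs d : #|{: pairs d}| = 'C(d, 2).
Proof.
rewrite card_sig -card_ltn_sorted_tuples.
pose f (x : 'I_d * 'I_d) := [tuple x.1; x.2].
have inj : injective f by move=> [? ?] [? ?] [-> ->].
rewrite -(card_imset _ inj); apply: eq_card => t.
rewrite finset.inE; apply/imsetP/idP => [[x xP ->]|].
  by move: xP; rewrite !inE /= andbT.
case/tupleP: t => i t; case/tupleP: t => j t; rewrite tuple0 /= andbT => ij.
by exists (i, j) => //; apply: val_inj.
Qed.

Definition triples (d : nat) := {x : 'I_d * 'I_d * 'I_d | (x.1.1 < x.1.2 < x.2)%N}.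

Lemma card_triples d : #|{: triples d}| = 'C(d, 3).
Proof.
rewrite card_sig -card_ltn_sorted_tuples.
pose f (x : 'I_d * 'I_d * 'I_d) := [tuple x.1.1; x.1.2; x.2].
have inj : injective f by move=> [[? ?] ?] [[? ?] ?] [-> -> ->].
rewrite -(card_imset _ inj); apply: eq_card => t.
rewrite finset.inE; apply/imsetP/idP => [[x xP ->]|].
  by move: xP; rewrite !inE /= andbT.
case/tupleP: t => i t; case/tupleP: t => j t; case/tupleP: t => k t.
rewrite tuple0 /= andbT => ij.
by exists (i, j, k) => //; apply: val_inj.
Qed.

Lemma gmorphX (G K : groupType) (f : {multiplicative G -> K}) x n :
  f (x ^+ n) = f x ^+ n.
Proof. by elim: n => [|n IH]; rewrite ?gmorph1 // !expgS gmulfM IH. Qed.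

Section TensorGenerators.
Variables A B : groupType.
Local Notation T := (tensor A B).

Lemma tensor_subgroup_ind (M : set T) :
  is_subgroup M -> (forall a b, M (tens a b)) -> forall t, M t.
Proof.
move=> sM Mt t; elim/tensor_ind: t => [|a b t IH|a b t IH]; first by case: sM.
  exact: is_subgroupM.
by apply: is_subgroupM => //; apply: is_subgroupV.
Qed.

Definition tensl (b : B) : {multiplicative A -> T} :=
  mult_hom (fun a a' => tensMl a a' b).
Definition tensr (a : A) : {multiplicative B -> T} := mult_hom (tensMr a).

Lemma generates_tens (I J : Type) (c : I -> A) (c' : J -> B) :
  generates c -> generates c' ->
  generates (fun ij : I * J => tens (c ij.1) (c' ij.2)).
Proof.
move=> gen gen' M sM Mc; apply: tensor_subgroup_ind => // a b.
apply: (gen _ (is_subgroup_preimage (tensl b) sM)) => i /=.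
apply: (gen' _ (is_subgroup_preimage (tensr (c i)) sM)) => j /=.
exact: (Mc (i, j)).
Qed.

Lemma tensor_exp (p : nat) (t : T) : (forall a : A, a ^+ p = 1) -> t ^+ p = 1.
Proof.
move=> Ap; move: t; apply: tensor_subgroup_ind => [|a b].
  split=> [|t u /= tp up]; first exact: expg1n.
  by rewrite expgMn ?tp ?expVgn ?up ?invg1 ?mulg1 //; exact: tensor_commute.
by have /= <- := gmorphX (tensl b) a p; rewrite Ap tens1l.
Qed.

(** The ring product of two additive maps is biadditive; such products form the coordinates on the
    tensor product. *)
Lemma tensor_functional (R : finComNzRingType)
    (k : {multiplicative A -> R}) (l : {multiplicative B -> R}) :
  exists m : {multiplicative T -> R}, forall a b, m (tens a b) = (k a * l b)%R.
Proof.
apply: tensor_lift => [a a' b|a b b'|a b a' b'].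
- by rewrite gmulfM GRing.mulrDl.
- by rewrite gmulfM GRing.mulrDr.
- exact: GRing.addrC.
Qed.

End TensorGenerators.

Lemma generates_pairs (p d : nat) (H : finGroupType) (e : 'I_d -> H) :
  special_pgroup p H -> generates e ->
  generates (fun x : pairs d => subcomm (e (\val x).1) (e (\val x).2)).
Proof.
move=> specialH gen M sM Mc; apply: (generates_subcomm specialH gen sM) => i j ij.
exact: (Mc (exist _ (i, j) ij)).
Qed.

(** * Coordinates on H' and the image of Psi2 *)

Section SpecialBasis.
Variables (p d : nat) (H : finGroupType).
Hypothesis p_pr : prime p.
Hypothesis specialH : special_pgroup p H.
Local Notation H' := (derived H).
Local Notation T := (tensor (subg_of H') (coset_of H')).
Implicit Types x y z : H.

Let sc x y : subg_of H' := subcomm x y.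
Let co : {multiplicative H -> coset_of H'} := coset_hom H.

Variable e : 'I_d -> H.
Hypothesis gen_e : generates e.
Variable v : 'I_d -> {multiplicative coset_of H' -> 'F_p}.
Hypothesis v_dual : dual_family (fun i => co (e i)) v.
Variable k : pairs d -> {multiplicative subg_of H' -> 'F_p}.
Hypothesis k_dual : dual_family (fun x : pairs d => sc (e (\val x).1) (e (\val x).2)) k.

(** The coordinates of H', indexed by i < j, extended by alternation to all ordered pairs, as for
    the exterior square of V. *)
Definition alt_coord (i j : 'I_d) (h : subg_of H') : 'F_p :=
  if insub (i, j) is Some x then k x h
  else if insub (j, i) is Some x then (- k x h)%R else 0%R.

Lemma alt_coordM i j g h :
  alt_coord i j (g * h) = (alt_coord i j g + alt_coord i j h)%R.
Proof.
rewrite /alt_coord; case: insub => [x|]; first by rewrite gmulfM.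
by case: insub => [x|]; rewrite ?gmulfM ?GRing.opprD ?GRing.addr0.
Qed.

Definition alt_coord_hom i j : {multiplicative subg_of H' -> 'F_p} :=
  mult_hom (alt_coordM i j).

Lemma alt_coord_lt (i j : 'I_d) (ij : (i < j)%N) h :
  alt_coord i j h = k (exist _ (i, j) ij) h.
Proof. by rewrite /alt_coord insubT. Qed.

Lemma alt_coordC i j h : alt_coord j i h = (- alt_coord i j h)%R.
Proof.
rewrite /alt_coord; case: insubP => [[x xP] /= ji xE|ji].
  by rewrite insubN /= ?GRing.opprK // -leqNgt ltnW.
case: insubP => // ij; by rewrite GRing.oppr0.
Qed.

Lemma alt_coordxx i h : alt_coord i i h = 0%R.
Proof. by rewrite /alt_coord insubN ?ltnn. Qed.

Lemma alt_coord_basis i j a b :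
  alt_coord i j (sc (e a) (e b))
    = ((i == a)%:R * (j == b)%:R - (j == a)%:R * (i == b)%:R)%R.
Proof.
wlog ij : i j / (i < j)%N => [wl|].
  case: (ltngtP i j) => [ij|ji|/val_inj->]; first exact: wl.
    by rewrite alt_coordC wl // GRing.opprB.
  by rewrite alt_coordxx GRing.subrr.
wlog ab : a b / (a < b)%N => [wl|].
  case: (ltngtP a b) => [ab|ba|/val_inj->]; first exact: wl.
    rewrite /sc -subcommV; transitivity (- alt_coord i j (sc (e b) (e a)))%R.
      exact: (gmorphV (alt_coord_hom i j)).
    by rewrite wl // GRing.opprB; congr (_ - _)%R; rewrite GRing.mulrC.
  rewrite /sc subcommxx; have := gmorph1 (alt_coord_hom i j) => /= ->.
  by rewrite [X in (_ - X)%R]GRing.mulrC GRing.subrr.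
rewrite (alt_coord_lt ij) (k_dual _ (exist _ (a, b) ab)) -val_eqE /= xpair_eqE.
rewrite -mulnb GRing.natrM; case: (eqVneq j a) => [ja|]; last first.
  by rewrite GRing.mul0r GRing.subr0.
case: (eqVneq i b) => [ib|]; last by rewrite GRing.mulr0 GRing.subr0.
by move: ab; rewrite -ja -ib ltnNge ltnW.
Qed.

Definition gen_coord i : {multiplicative H -> 'F_p} := v i \o co.

Lemma gen_coordM i x y : gen_coord i (x * y) = (gen_coord i x + gen_coord i y)%R.
Proof. exact: gmulfM. Qed.

Lemma gen_coord_basis i j : gen_coord i (e j) = (i == j)%:R%R.
Proof. exact: v_dual. Qed.

(** The coordinates of a commutator are 2 by 2 minors: both sides are additive in x and in y and
    agree on the generators. *)
Lemma alt_coord_comm i j x y :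
  alt_coord i j (sc x y)
    = (gen_coord i x * gen_coord j y - gen_coord j x * gen_coord i y)%R.
Proof.
have commr a : alt_coord i j (sc (e a) y)
      = (gen_coord i (e a) * gen_coord j y - gen_coord j (e a) * gen_coord i y)%R.
  pose f y := (gen_coord i (e a) * gen_coord j y - gen_coord j (e a) * gen_coord i y)%R.
  have fM y1 y2 : f (y1 * y2) = (f y1 + f y2)%R.
    by rewrite /f !gen_coordM !GRing.mulrDr GRing.opprD GRing.addrACA.
  apply: (eq_hom (f := alt_coord_hom i j \o subcommr specialH (e a))
    (g := mult_hom fM) gen_e) => b /=.
  by rewrite alt_coord_basis /f !gen_coord_basis.
pose f x := (gen_coord i x * gen_coord j y - gen_coord j x * gen_coord i y)%R.
have fM x1 x2 : f (x1 * x2) = (f x1 + f x2)%R.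
  by rewrite /f !gen_coordM !GRing.mulrDl GRing.opprD GRing.addrACA.
by apply: (eq_hom (f := alt_coord_hom i j \o subcomml specialH y)
  (g := mult_hom fM) gen_e) => b /=.
Qed.

Lemma alt_coord_eq1 h : (forall i j, alt_coord i j h = 0%R) -> h = 1.
Proof.
have [g [f [gc gk gK _]]] := dual_family_bij p_pr
  (fun _ _ => commute_subg_derived specialH _ _)
  (fun _ => subg_derived_exp p_pr specialH _)
  (generates_pairs specialH gen_e) k_dual.
move=> h0; rewrite -(gK h) -(gmorph1 f); congr (f _); apply/rowP => r.
rewrite -[r]enum_valK gk mxE -[RHS](h0 (val (enum_val r)).1 (val (enum_val r)).2).
by case: (enum_val r) => -[i j] ij /=; rewrite (alt_coord_lt ij).
Qed.

(** The value of [Psi2] on the classes of x, y, z. It is shown below to be additive in each argument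
    and alternating. *)
Definition psi_form x y z : T :=
  tens (sc x y) (co z) * tens (sc z x) (co y) * tens (sc y z) (co x).

Lemma psi_form_cycle x y z : psi_form x y z = psi_form y z x.
Proof. by rewrite /psi_form -[RHS]mulgA; exact: tensor_commute. Qed.

Lemma psi_formMl x x' y z : psi_form (x * x') y z = psi_form x y z * psi_form x' y z.
Proof.
rewrite /psi_form /sc (subcommMl specialH) (subcommMr specialH) gmulfM !tensMl tensMr.
have ACA (a b a' b' : T) : (a * b) * (a' * b') = (a * a') * (b * b').
  by rewrite !mulgA -(mulgA a b) (tensor_commute b) !mulgA.
by rewrite [RHS]ACA; congr (_ * _); exact: ACA.
Qed.

Definition psi_form_hom y z : {multiplicative H -> T} :=
  mult_hom (fun x x' => psi_formMl x x' y z).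

Lemma psi_formMm x y y' z : psi_form x (y * y') z = psi_form x y z * psi_form x y' z.
Proof. by rewrite psi_form_cycle psi_formMl -!(psi_form_cycle x). Qed.

Lemma psi_formxx x z : psi_form x x z = 1.
Proof.
by rewrite /psi_form /sc subcommxx tens1l mul1g -tensMl -(subcommV x z) mulVg tens1l.
Qed.

Lemma psi_formV x y z : psi_form y x z = (psi_form x y z)^-1.
Proof.
apply: (mulgI (psi_form x y z)); rewrite mulgV -(psi_formxx (x * y) z).
by rewrite psi_formMl !psi_formMm !psi_formxx mul1g mulg1.
Qed.

Definition Psi2_image : set T := range (Psi2 H).

Lemma Psi2_hom : is_Psi2 (Psi2 H).
Proof. exact/Psi2P/(special_centerE specialH). Qed.

Lemma is_subgroup_Psi2_image : is_subgroup Psi2_image.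
Proof. by apply: (is_subgroup_image (mult_hom (proj1 Psi2_hom))); split. Qed.

Lemma psi_form_Psi2_image x y z : Psi2_image (psi_form x y z).
Proof. by eexists; last exact: (proj2 Psi2_hom x y z). Qed.

Lemma Psi2_image_min (M : set T) :
  is_subgroup M -> (forall x y z, M (psi_form x y z)) -> Psi2_image `<=` M.
Proof.
move=> sM Mf _ [t _ <-].
have sM' := is_subgroup_preimage (mult_hom (proj1 Psi2_hom)) sM.
move: t; apply: (tensor_subgroup_ind sM') => t c.
have sMc := is_subgroup_preimage (tensl _ c) sM'.
suff Mc a b : (tensl _ c @^-1` (mult_hom (proj1 Psi2_hom) @^-1` M)) (tens a b).
  exact: (tensor_subgroup_ind sMc Mc t).
rewrite -(coset_reprK a) -(coset_reprK b) -(coset_reprK c) /=.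
by rewrite (proj2 Psi2_hom); exact: Mf.
Qed.

Lemma Psi2_image_min_basis (M : set T) : is_subgroup M ->
    (forall i j l : 'I_d, (i < j < l)%N -> M (psi_form (e i) (e j) (e l))) ->
  Psi2_image `<=` M.
Proof.
move=> sM Mlt.
(* A cyclic shift and a transposition generate all permutations of the three indices, so membership
   reduces to increasing triples; repeated indices give the trivial element. *)
have Mcyc i j l : M (psi_form (e i) (e j) (e l)) -> M (psi_form (e j) (e l) (e i)).
  by rewrite psi_form_cycle.
have Mswap i j l : M (psi_form (e i) (e j) (e l)) -> M (psi_form (e j) (e i) (e l)).
  by move=> Mijl; rewrite psi_formV; apply: (is_subgroupV sM).
have M1 i l : M (psi_form (e i) (e i) (e l)) by rewrite psi_formxx; case: sM.
have Mbasis i j l : M (psi_form (e i) (e j) (e l)).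
  have Meq2 a b : M (psi_form (e a) (e b) (e b)) by apply/Mcyc/Mcyc.
  case: (ltngtP i j) => [ij|ji|/val_inj->] //.
    case: (ltngtP j l) => [jl|lj|/val_inj->] //; first by apply: Mlt; rewrite ij.
    case: (ltngtP i l) => [il|li|/val_inj->]; last exact: Mcyc.
      by apply/Mcyc/Mswap/Mlt; rewrite il.
    by apply/Mcyc/Mlt; rewrite li.
  case: (ltngtP i l) => [il|li|/val_inj->]; last exact: Mcyc.
    by apply/Mswap/Mlt; rewrite ji.
  case: (ltngtP j l) => [jl|lj|/val_inj->] //.
    by apply/Mcyc/Mcyc/Mlt; rewrite jl.
  by apply/Mcyc/Mcyc/Mswap/Mlt; rewrite lj.
apply: Psi2_image_min => // x y z.
apply: (gen_e (is_subgroup_preimage (psi_form_hom y z) sM)) => i /=.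
rewrite psi_form_cycle.
apply: (gen_e (is_subgroup_preimage (psi_form_hom z (e i)) sM)) => j /=.
rewrite psi_form_cycle.
apply: (gen_e (is_subgroup_preimage (psi_form_hom (e i) (e j)) sM)) => l /=.
by rewrite psi_form_cycle.
Qed.

End SpecialBasis.

Lemma elementary_exp (p n : nat) (x : elementary_abelian p n) : prime p -> x ^+ p = 1.
Proof.
by move=> p_pr; rewrite FinRing.zmodXgE -GRing.scaler_nat pchar_Fp_0 ?GRing.scale0r.
Qed.

(** The subgroup A is generated by the independent vectors [c i]: the homomorphism sending unit
    vectors to them has range A and is injective, because the dual coordinates undo it. *)
Lemma card_dual_family (p n : nat) (I : finType) (c : I -> elementary_abelian p n)
    (k : I -> {multiplicative elementary_abelian p n -> 'F_p})
    (A : set 'rV['F_p]_n) :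
    prime p -> dual_family c k -> (forall i, A (c i)) ->
    (forall M : set 'rV['F_p]_n, is_subgroup M -> (forall i, M (c i)) -> A `<=` M) ->
    is_subgroup A ->
  #|finite_part A| = (p ^ #|I|)%N.
Proof.
move=> p_pr kc Ac Amin sA.
have cC i j : commute (c i) (c j) by exact: GRing.addrC.
have cp i : c i ^+ p = 1 by exact: elementary_exp.
have [f fc] := elementary_hom p_pr (fun i j : 'I_#|I| => cC (enum_val i) (enum_val j))
  (fun i => cp (enum_val i)).
have [g [gc _]] := dual_family_coordinates kc.
have fK : cancel f g.
  apply: (eq_hom (f := g \o f) (g := idfun) (@generates_unit_vec p #|I|)) => i /=.
  by rewrite fc gc enum_valK.
have sf : is_subgroup (range f) by apply: is_subgroup_image; split.
have <- : #|{: elementary_abelian p #|I|}| = (p ^ #|I|)%N.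
  by rewrite card_mx mul1n card_Fp.
rewrite -(card_imset _ (can_inj fK)); apply: eq_card => x.
rewrite finset.inE; apply/asboolP/imsetP => [/Amin|[y _ ->]].
  move=> /(_ _ sf)[|y _ <-]; last by exists y.
  by move=> i; exists (unit_vec p (enum_rank i)); rewrite ?fc ?enum_rankK.
apply: (generates_unit_vec (is_subgroup_preimage f sA)) => i /=.
by rewrite fc.
Qed.

(** * A basis of the tensor product and the order of Im Psi2 *)

Section TensorCoordinates.
Variables (p d : nat) (H : finGroupType).
Hypothesis p_pr : prime p.
Hypothesis specialH : special_pgroup p H.
Local Notation H' := (derived H).
Local Notation T := (tensor (subg_of H') (coset_of H')).
Implicit Types x y z : H.
Local Notation sc x y := (subcomm x y).
Local Notation co := (coset_hom H).

Variable e : 'I_d -> H.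
Hypothesis gen_e : generates e.
Variable v : 'I_d -> {multiplicative coset_of H' -> 'F_p}.
Hypothesis v_dual : dual_family (fun i => co (e i)) v.
Variable k : pairs d -> {multiplicative subg_of H' -> 'F_p}.
Hypothesis k_dual : dual_family (fun x : pairs d => sc (e (\val x).1) (e (\val x).2)) k.

Definition tensor_coord (i j l : 'I_d) : {multiplicative T -> 'F_p} :=
  sval (cid (tensor_functional (alt_coord_hom k i j) (v l))).

Lemma tensor_coordE i j l a b :
  tensor_coord i j l (tens a b) = (alt_coord k i j a * v l b)%R.
Proof. exact: (svalP (cid (tensor_functional (alt_coord_hom k i j) (v l)))). Qed.

(** This is the 3 by 3 determinant of the coordinates i, j, l of x, y, z, expanded along the column
    l. Antisymmetry in the indices follows. *)
Lemma tensor_coord_psi_form i j l x y z : tensor_coord i j l (psi_form x y z) =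
  ((gen_coord v i x * gen_coord v j y - gen_coord v j x * gen_coord v i y) * gen_coord v l z
   + (gen_coord v i z * gen_coord v j x - gen_coord v j z * gen_coord v i x)
     * gen_coord v l y
   + (gen_coord v i y * gen_coord v j z - gen_coord v j y * gen_coord v i z)
     * gen_coord v l x)%R.
Proof.
have E a b : tensor_coord i j l (a * b) = (tensor_coord i j l a + tensor_coord i j l b)%R.
  exact: gmulfM.
by rewrite /psi_form !E !tensor_coordE !(alt_coord_comm specialH gen_e v_dual k_dual).
Qed.

Lemma tensor_coord_Psi2_image i j l t :
  Psi2_image t -> tensor_coord i l j t = (- tensor_coord i j l t)%R.
Proof.
move: t; apply: (Psi2_image_min specialH) => [|x y z].
  split=> [|t u /= it iu]; first by rewrite /= !gmorph1 GRing.oppr0.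
  have E a b c : tensor_coord a b c (t * u^-1)
      = (tensor_coord a b c t - tensor_coord a b c u)%R.
    by rewrite gmulfM gmorphV.
  by rewrite !E it iu GRing.opprB GRing.opprK GRing.addrC.
by rewrite /= !tensor_coord_psi_form; ring.
Qed.

Lemma delta_lt0 (R : pzRingType) (i j a b : 'I_d) : (i < j)%N -> (b < a)%N ->
  ((i == a)%:R * (j == b)%:R = 0 :> R)%R.
Proof.
move=> ij ba; case: eqP => [ia|_]; last by rewrite GRing.mul0r.
case: eqP => [jb|_]; last by rewrite GRing.mulr0.
by move: ij; rewrite ia jb ltnNge ltnW.
Qed.

Definition psi_triple (r : triples d) : T :=
  psi_form (e (\val r).1.1) (e (\val r).1.2) (e (\val r).2).

Lemma psi_triple_dual : dual_family psi_triple
  (fun r : triples d => tensor_coord (\val r).1.1 (\val r).1.2 (\val r).2).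
Proof.
move=> [[[i j] l] ijl] [[[a b] c] abc]; rewrite -val_eqE /= !xpair_eqE.
have /= /andP[ij jl] := ijl; have /= /andP[ab bc] := abc.
rewrite /psi_triple /= tensor_coord_psi_form !(gen_coord_basis v_dual).
have il := ltn_trans ij jl; have ac := ltn_trans ab bc.
rewrite -!mulnb !GRing.natrM.
(* Of the six terms of the determinant only the identity survives: any other permutation has an
   inversion, which two increasing triples cannot match. *)
have z1 := delta_lt0 'F_p ij ab; have z2 := delta_lt0 'F_p ij ac.
have z3 := delta_lt0 'F_p jl bc; have z4 := delta_lt0 'F_p il ab.
have z5 := delta_lt0 'F_p il ac.
set ia : 'F_p := (i == a)%:R%R in z1 z2 z3 z4 z5 *.
set ib : 'F_p := (i == b)%:R%R in z1 z2 z3 z4 z5 *.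
set ic : 'F_p := (i == c)%:R%R in z1 z2 z3 z4 z5 *.
set ja : 'F_p := (j == a)%:R%R in z1 z2 z3 z4 z5 *.
set jb : 'F_p := (j == b)%:R%R in z1 z2 z3 z4 z5 *.
set jc : 'F_p := (j == c)%:R%R in z1 z2 z3 z4 z5 *.
set la : 'F_p := (l == a)%:R%R in z1 z2 z3 z4 z5 *.
set lb : 'F_p := (l == b)%:R%R in z1 z2 z3 z4 z5 *.
set lc : 'F_p := (l == c)%:R%R in z1 z2 z3 z4 z5 *.
transitivity (ia * jb * lc - (ib * ja) * lc + (ic * ja) * lb - (jc * lb) * ia
  + (ib * la) * jc - (ic * la) * jb)%R; first by ring.
by rewrite z1 z2 z3 z4 z5 !GRing.mul0r !(GRing.subr0, GRing.addr0).
Qed.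

Definition tensor_basis (q : pairs d * 'I_d) : T :=
  tens (sc (e (\val q.1).1) (e (\val q.1).2)) (co (e q.2)).

Lemma generates_tensor_basis : generates tensor_basis.
Proof.
exact: (generates_tens (generates_pairs specialH gen_e) (generates_coset gen_e)).
Qed.

Lemma tensor_basis_dual : dual_family tensor_basis
  (fun q : pairs d * 'I_d => tensor_coord (\val q.1).1 (\val q.1).2 q.2).
Proof.
move=> [[[i j] ij] l] [[[a b] ab] c]; rewrite xpair_eqE -mulnb GRing.natrM /tensor_basis /=.
rewrite tensor_coordE -/(gen_coord v l (e c)) (alt_coord_lt k ij).
congr (_ * _)%R; last exact: v_dual.
exact: (k_dual (exist _ (i, j) ij) (exist _ (a, b) ab)).
Qed.

Lemma special_tensor_exp (t : T) : t ^+ p = 1.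
Proof. by apply: tensor_exp; exact: subg_derived_exp. Qed.

Lemma tensor_coordinates :
  exists (g : {multiplicative T -> elementary_abelian p #|{: pairs d * 'I_d}|})
         (f : {multiplicative elementary_abelian p #|{: pairs d * 'I_d}| -> T}),
    cancel g f /\ cancel f g.
Proof.
have [g [f [_ _ gK fK]]] := dual_family_bij p_pr
  (fun _ _ => tensor_commute _ _) (fun _ => special_tensor_exp _)
  generates_tensor_basis tensor_basis_dual.
by exists g, f.
Qed.

Lemma card_Psi2_image n (g : {multiplicative T -> elementary_abelian p n})
    (f : {multiplicative elementary_abelian p n -> T}) :
    cancel g f -> cancel f g ->
  #|finite_part (f @^-1` @Psi2_image H)| = (p ^ 'C(d, 3))%N.
Proof.
move=> gK fK; rewrite -card_triples.
pose kf (r : triples d) : {multiplicative elementary_abelian p n -> 'F_p} :=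
  tensor_coord (\val r).1.1 (\val r).1.2 (\val r).2 \o f.
have kd : dual_family (g \o psi_triple) kf.
  by move=> r s; rewrite /kf /= gK; exact: psi_triple_dual.
apply: (card_dual_family p_pr kd).
- by move=> r; rewrite /= gK; exact: (psi_form_Psi2_image specialH).
- move=> M sM Mg x /= Px; rewrite -[x]fK.
  have sMg := is_subgroup_preimage g sM.
  apply: (Psi2_image_min_basis specialH gen_e sMg) Px => i j l ijl.
  exact: (Mg (exist _ (i, j, l) ijl)).
exact: is_subgroup_preimage (is_subgroup_Psi2_image specialH).
Qed.

Lemma power_tensors_Psi2_image :
  power_tensors H p `<=` @Psi2_image H -> forall i, e i ^+ p = 1.
Proof.
move=> PI l; have lH := exp_derived p_pr specialH (e l).
suff : subg H' (e l ^+ p) = 1.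
  by move=> /(congr1 sgval); rewrite subgK.
apply: (alt_coord_eq1 p_pr specialH gen_e k_dual) => i j.
pose t := tens (subg H' (e l ^+ p)) (coset_hom H (e l)).
have tI : Psi2_image t by apply: PI; apply: sub_generated; exists (e l).
have tE a b c : tensor_coord a b c t
    = (alt_coord k a b (subg H' (e l ^+ p)) * (c == l)%:R)%R.
  by rewrite tensor_coordE v_dual.
(* Antisymmetry turns the coordinate (a, b, l) of [t] into minus the coordinate (a, l, b), which
   contains the vanishing factor (b == l). The case left over, where the second index is l, follows
   since [alt_coord] is alternating. *)
have main a b : b != l -> alt_coord k a b (subg H' (e l ^+ p)) = 0%R.
  move=> bl; have := tensor_coord_Psi2_image a b l tI.
  rewrite !tE eqxx (negbTE bl) GRing.mulr1 GRing.mulr0 => /esym/eqP.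
  by rewrite GRing.oppr_eq0 => /eqP.
case: (eqVneq j l) => [->|]; last exact: main.
case: (eqVneq i l) => [->|il]; first exact: alt_coordxx.
by rewrite alt_coordC main // GRing.oppr0.
Qed.

End TensorCoordinates.

Lemma card_fset_set_coordinates (p n : nat) (G : groupType)
    (g : G -> 'rV['F_p]_n) (f : 'rV['F_p]_n -> G) (A : set G) :
  cancel g f -> cancel f g -> #|` fset_set A| = #|finite_part (f @^-1` A)|.
Proof.
move=> gK fK.
(* The operation [fset_set] is faithful only on finite sets, so finiteness is first read off the
   coordinates. *)
have finA : finite_set A.
  apply: (@sub_finite_set _ _ (range f)); first by move=> x _; exists (g x).
  exact/finite_image/finite_finset.
rewrite cardE -(size_map f); apply/perm_size/uniq_perm.
- exact: fset_uniq.
- by rewrite map_inj_uniq ?enum_uniq //; exact: can_inj fK.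
move=> x; rewrite in_fset_set //.
apply/idP/mapP => [|[y + ->]].
  by move=> /set_mem Ax; exists (g x); rewrite ?gK // mem_enum finset.inE;
    apply/asboolP; rewrite /= gK.
by rewrite mem_enum finset.inE => /asboolP ?; apply/mem_set.
Qed.

(** * The map beta *)

Section HallWitt.
Variable G : groupType.
Implicit Types x y z : G.

Lemma group_Hall_Witt x y z :
  [~ x, y^-1, z] ^ y * [~ y, z^-1, x] ^ z * [~ z, x^-1, y] ^ x = 1.
Proof.
by rewrite !(commgEl, conjgE, invgM, invgK, mulgA) !(mulgK, mulgVK, mulVg, mulgV, mul1g).
Qed.

Hypothesis class3 : forall x y z g, commute [~ x, y, z] g.

(** The commutators [x, y^-1] and [y, x] differ by the factor [y, x, y^-1], which is central in
    class 3. *)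
Lemma commVr_class3 x y z : [~ x, y^-1, z] = [~ y, x, z].
Proof.
have -> : [~ x, y^-1] = [~ y, x] * [~ [~ y, x], y^-1].
  rewrite [in RHS]commgEl mulVKg.
  by rewrite !(commgEl, conjgE, invgM, invgK, mulgA) !(mulgK, mulgVK, mulVg, mulgV, mul1g).
have := comm_central_mul [~ y, x] z (class3 y x y^-1) (fun g => commute_sym (commute1 g)).
by rewrite mulg1.
Qed.

(* The Hall-Witt identity loses its conjugations in class 3. *)
Lemma commg_jacobi x y z : [~ x, y, z] * [~ z, x, y] * [~ y, z, x] = 1.
Proof.
have := group_Hall_Witt y x z; rewrite !commVr_class3.
have cJ (a b c g : G) : [~ a, b, c] ^ g = [~ a, b, c].
  exact: (conj_central g (class3 a b c)).
by rewrite !cJ.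
Qed.
End HallWitt.

Lemma commutators_subgroup (G : groupType) (A B : set G) : is_subgroup (commutators A B).
Proof. exact: is_subgroup_generated. Qed.

Lemma commutators_mem (G : groupType) (A B : set G) a b :
  A a -> B b -> commutators A B [~ a, b].
Proof. by move=> Aa Bb; apply: sub_generated; exists a => //; exists b. Qed.

(** * Commutators above H as a function of commutators in H; applied to F / [S, F] and to the
    presented group *)

Section CommutatorHom.
Variables (p d : nat) (H : finGroupType) (G Q : groupType).
Hypothesis p_pr : prime p.
Hypothesis specialH : special_pgroup p H.
Local Notation H' := (derived H).
Variable e : 'I_d -> H.
Hypothesis gen_e : generates e.
Variable k : pairs d -> {multiplicative subg_of H' -> 'F_p}.
Hypothesis k_dual :
  dual_family (fun x : pairs d => subcomm (e (\val x).1) (e (\val x).2)) k.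
Variables (phi : {multiplicative G -> H}) (q : {multiplicative G -> Q}).
Hypothesis phi_onto : forall h, exists x, phi x = h.
Hypothesis q_central : forall s, phi s \in H' -> forall x, commute (q s) (q x).
Hypothesis q_exp : forall x y, [~ q x, q y] ^+ p = 1.

(** An element and a product of the lifts [y i] with the same image in H differ by an element of the
    kernel, which lies over H'. *)
Lemma preimage_generates (M : set G) (y : 'I_d -> G) :
    (forall i, phi (y i) = e i) -> is_subgroup M -> (forall i, M (y i)) ->
  (forall s, phi s \in H' -> M s) -> forall x, M x.
Proof.
move=> ye sM My MS x.
have : (phi @` M) (phi x).
  apply: gen_e; first exact: is_subgroup_image.
  by move=> i; exists (y i).
case=> m Mm mx; rewrite -(mulVKg m x); apply: (is_subgroupM sM) => //.
by apply: MS; rewrite gmulfM gmorphV mx mulVg group1.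
Qed.

Let comm_derivedG x y : phi [~ x, y] \in H'.
Proof. by rewrite gmorphR comm_derived. Qed.

Let q_comm_central x y z : commute [~ q x, q y] (q z).
Proof. by rewrite -gmorphR; apply: q_central. Qed.

Let q_commMl y x x' : [~ q (x * x'), q y] = [~ q x, q y] * [~ q x', q y].
Proof.
have -> : [~ q (x * x'), q y] = [~ q x, q y] ^ q x' * [~ q x', q y].
  by rewrite gmulfM !commgEl !conjgE !invgM !mulgA !mulgK.
by rewrite conjgE (q_comm_central x y x') mulKg.
Qed.

Let q_commMr x y y' : [~ q x, q (y * y')] = [~ q x, q y] * [~ q x, q y'].
Proof.
rewrite -invgR q_commMl invgM !invgR -(gmorphR q x y).
exact: q_comm_central.
Qed.

(* Commutators in q(G) depend biadditively on their arguments modulo H', and  *)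
(* the [e i, e j] are a basis of H', so the commutator of H determines that   *)
(* of q(G).                                                                   *)
Lemma commutator_hom : exists tau : {multiplicative subg_of H' -> Q},
  forall x y, q [~ x, y] = tau (subcomm (phi x) (phi y)).
Proof.
have /choice[y ye] : forall i, exists x, phi x = e i by move=> i.
have [g [_ [gc _ _ _]]] := dual_family_bij p_pr
  (fun _ _ => commute_subg_derived specialH _ _)
  (fun _ => subg_derived_exp p_pr specialH _)
  (generates_pairs specialH gen_e) k_dual.
pose c (r : 'I_#|{: pairs d}|) :=
  [~ q (y (\val (enum_val r)).1), q (y (\val (enum_val r)).2)].
have cC r s : commute (c r) (c s).
  by rewrite /c -[[~ q (y (\val (enum_val s)).1), _]]gmorphR; apply: q_comm_central.
have [f fc] := elementary_hom p_pr cC (fun _ => q_exp _ _).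
pose tau : {multiplicative subg_of H' -> Q} := f \o g.
have tau_lt (i j : 'I_d) : (i < j)%N -> tau (subcomm (e i) (e j)) = [~ q (y i), q (y j)].
  move=> ij; rewrite /tau /= (gc (exist _ (i, j) ij)) fc /c enum_rankK //.
have tau_basis i j : [~ q (y i), q (y j)] = tau (subcomm (e i) (e j)).
  case: (ltngtP i j) => [ij|ji|/val_inj->]; first by rewrite tau_lt.
    by rewrite -invgR -tau_lt // -gmorphV subcommV.
  by rewrite commgg subcommxx gmorph1.
exists tau => x z; rewrite gmorphR.
pose L z : {multiplicative G -> Q} := mult_hom (q_commMl z).
pose R z : {multiplicative G -> Q} := tau \o subcomml specialH (phi z) \o phi.
pose L' x : {multiplicative G -> Q} := mult_hom (q_commMr x).
pose R' x : {multiplicative G -> Q} := tau \o subcommr specialH (phi x) \o phi.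
have sub1 h h' : h \in H' -> subcomm h h' = 1 /\ subcomm h' h = 1.
  move=> hH; have [h1 h2] : [~ h, h'] = 1 /\ [~ h', h] = 1.
    by split; apply/eqP/commgP; [|apply/commute_sym]; exact: (derived_central specialH hH).
  by rewrite /subcomm h1 h2 subg_derived1.
apply: (preimage_generates ye (is_subgroup_eq_hom (L z) (R z))) => [i|s sH] /=; last first.
  have [-> _] := sub1 _ (phi z) sH; rewrite !gmorph1.
  by apply/eqP/commgP/q_central.
have sLR := is_subgroup_eq_hom (L' (y i)) (R' (y i)).
apply: (preimage_generates ye sLR) => [j|s sH] /=; last first.
  have [_ ->] := sub1 _ (phi (y i)) sH; rewrite !gmorph1.
  by apply/eqP/commgP/commute_sym/q_central.
by rewrite !ye.
Qed.

Lemma is_subgroup_tau (tau : {multiplicative subg_of H' -> Q}) :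
  is_subgroup [set r | phi r \in H' /\ q r = tau (subg H' (phi r))].
Proof.
split=> [|x y /= [xH qx] [yH qy]] /=.
  by rewrite !gmorph1 group1 subg_derived1 gmorph1.
rewrite !gmulfM !gmorphV groupM ?groupV //; split=> //.
rewrite subgM ?groupV // gmulfM -qx; congr (_ * _).
rewrite qy -(gmorphV tau); congr (tau _).
by apply: val_inj; rewrite /= !subgK ?groupV.
Qed.

(** On the derived subgroup [q] factors as [tau] after [phi], so whatever [phi] kills there is
    killed by [q]. *)
Lemma commutator_hom_derived (tau : {multiplicative subg_of H' -> Q}) :
    (forall x y, q [~ x, y] = tau (subcomm (phi x) (phi y))) ->
  forall r, commutators setT setT r -> phi r = 1 -> q r = 1.
Proof.
move=> tauE r rF r1; suff [_ ->] : phi r \in H' /\ q r = tau (subg H' (phi r)).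
  by rewrite r1 subg_derived1 gmorph1.
apply: (generated_min (is_subgroup_tau tau)) rF => _ [x _ [y _ ->]] /=.
by split; [exact: comm_derivedG | rewrite tauE /subcomm gmorphR].
Qed.

End CommutatorHom.

Section Beta.
Variables (p d : nat) (H : finGroupType).
Hypothesis p_pr : prime p.
Hypothesis specialH : special_pgroup p H.
Local Notation H' := (derived H).
Variable e : 'I_d -> H.
Hypothesis gen_e : generates e.
Variable k : pairs d -> {multiplicative subg_of H' -> 'F_p}.
Hypothesis k_dual :
  dual_family (fun x : pairs d => subcomm (e (\val x).1) (e (\val x).2)) k.
Variables (X : choiceType) (phi : {multiplicative free_group X -> H}).
Hypothesis phi_onto : forall h, exists x, phi x = h.
Local Notation F := (free_group X).
Local Notation T := (tensor (subg_of H') (coset_of H')).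
Implicit Types x y z r s : F.

Let q : {multiplicative F -> quotg (RF phi)} := quotg_proj (RF phi).

Lemma beta_is_beta : is_beta phi (beta phi).
Proof. exact: betaP phi_onto (special_class2 specialH). Qed.

Definition beta_hom : {multiplicative T -> quotg (RF phi)} :=
  mult_hom (proj1 beta_is_beta).

Lemma betaE x z : phi x \in H' ->
  beta phi (tens (subg H' (phi x)) (coset_hom H (phi z))) = q [~ x, z].
Proof. exact: (proj2 beta_is_beta x z). Qed.

Lemma quotg_RF_central r : phi r = 1 -> forall u, commute (q r) u.
Proof.
move=> r1 u; rewrite -[u]quotg_projK; apply/commgP/eqP; rewrite -gmorphR.
by apply: quotg_proj_rel; apply: commutators_mem.
Qed.

Lemma phi_commg x y : phi x \in H' -> phi [~ x, y] = 1.
Proof.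
by move=> xH; rewrite gmorphR; apply/eqP/commgP; exact: (derived_central specialH xH).
Qed.

Lemma beta_sub_schur : range (beta phi) `<=` schur_multiplier phi.
Proof.
have sS : is_subgroup (schur_multiplier phi).
  apply: (is_subgroup_image q); have [K1 KF] := kernel_subgroup phi.
  have [C1 CF] := commutators_subgroup (G := F) setT setT.
  by split=> // x y [Kx Cx] [Ky Cy]; split; [exact: KF | exact: CF].
move=> _ [t _ <-]; move: t.
apply: (tensor_subgroup_ind (is_subgroup_preimage beta_hom sS)) => a b.
have [x xa] := phi_onto (sgval a); have [z zb] := phi_onto (fingroup.repr b).
have xH : phi x \in H' by rewrite xa; exact: subgP.
rewrite /= -(sgvalK a) -xa -(coset_reprK b) -zb [beta _ _]betaE //.
by exists [~ x, z] => //; split; [exact: phi_commg | exact: commutators_mem].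
Qed.

Local Notation SF := (commutators (phi @^-1` [set h | h \in H']) setT).

(** A generator [s, f] of [S, F] maps to the value of beta on a pure tensor. It lies in R because H'
    is central, so its image is central in F / [R, F] and is unchanged by the conjugations of the
    normal closure. *)
Lemma quotg_SF_beta r : normal_closure SF r -> range (beta phi) (q r).
Proof.
pose M : set F := [set r | phi r = 1 /\ range (beta phi) (q r)].
have sR : is_subgroup (range (beta phi)).
  by apply: (is_subgroup_image beta_hom); split.
have sM : is_subgroup M.
  split=> [|x y /= [x1 bx] [y1 bz]]; rewrite /M /=.
    by rewrite !gmorph1; split=> //; case: sR.
  rewrite !gmulfM !gmorphV x1 y1 mulgV; split=> //.
  exact: (proj2 sR).
suff sub : normal_closure SF `<=` M by move=> /sub[].
apply: generated_min => // _ [a Sa [g ->]].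
suff [a1 ba] : M a.
  split; first by rewrite gmorphJ a1 conj1g.
  by rewrite gmorphJ (conj_central _ (quotg_RF_central a1)).
move: a Sa; apply: generated_min => // _ [s /= sH [f _ ->]].
split; first exact: phi_commg.
by rewrite -betaE //; eexists.
Qed.

Lemma exp_preimage_derived x : phi (x ^+ p) \in H'.
Proof. by rewrite gmorphX exp_derived. Qed.

Lemma schur_sub_beta : schur_multiplier phi `<=` range (beta phi).
Proof.
move=> _ [r [/= r1 rF] <-]; apply: quotg_SF_beta; apply/quotg_proj_eq1.
pose qS : {multiplicative F -> quotg SF} := quotg_proj SF.
have qS_central s : phi s \in H' -> forall x, commute (qS s) (qS x).
  move=> sH x; apply/commgP/eqP; rewrite -gmorphR.
  by apply: quotg_proj_rel; apply: commutators_mem.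
(* Commutators in F / [S, F] are additive in x, and x^p lies over H', hence becomes central. *)
have qS_exp x y : [~ qS x, qS y] ^+ p = 1.
  have cM x1 x2 : [~ qS (x1 * x2), qS y] = [~ qS x1, qS y] * [~ qS x2, qS y].
    have -> : [~ qS (x1 * x2), qS y] = [~ qS x1, qS y] ^ qS x2 * [~ qS x2, qS y].
      by rewrite gmulfM !commgEl !conjgE !invgM !mulgA !mulgK.
    rewrite -(gmorphR qS) conjgE (qS_central [~ x1, y]) ?mulKg //.
    by rewrite gmorphR comm_derived.
  have <- := gmorphX (mult_hom cM) x p.
  by apply/eqP/commgP/qS_central/exp_preimage_derived.
have [tau tauE] := commutator_hom p_pr specialH gen_e k_dual phi_onto qS_central qS_exp.
exact: (commutator_hom_derived tauE rF r1).
Qed.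

Lemma schur_multiplierE : schur_multiplier phi = range (beta phi).
Proof. by apply/seteqP; split; [exact: schur_sub_beta | exact: beta_sub_schur]. Qed.

Lemma power_tensors_ker_beta : power_tensors H p `<=` kernel (beta phi).
Proof.
apply: generated_min; first exact: (kernel_subgroup beta_hom).
move=> _ [w ->]; have [x xw] := phi_onto w.
rewrite /kernel /= -xw -gmorphX [LHS]betaE ?exp_preimage_derived //.
have -> : [~ x ^+ p, x] = 1 by apply/eqP/commgP/commute_sym/commuteX.
exact: gmorph1.
Qed.

Lemma Psi2_image_ker_beta : @Psi2_image H `<=` kernel (beta phi).
Proof.
apply: (Psi2_image_min specialH); first exact: (kernel_subgroup beta_hom).
move=> x y z; rewrite /kernel /=.
have [x' <-] := phi_onto x; have [y' <-] := phi_onto y; have [z' <-] := phi_onto z.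
have betaR u v w : beta phi (tens (subcomm (phi u) (phi v)) (coset_hom H (phi w))) =
    [~ q u, q v, q w].
  rewrite /subcomm -(gmorphR phi) betaE ?(gmorphR phi) ?comm_derived //.
  by rewrite !(gmorphR q).
rewrite /psi_form !(proj1 beta_is_beta) !betaR; apply: commg_jacobi => a b c g.
have q_onto u : exists x, q x = u by exists (repr u); exact: quotg_projK.
have [a' <-] := q_onto a; have [b' <-] := q_onto b; have [c' <-] := q_onto c.
rewrite -(gmorphR q a' b') -(gmorphR q _ c').
by apply: quotg_RF_central; apply: phi_commg; rewrite gmorphR comm_derived.
Qed.

End Beta.

(** * The kernel of beta *)

Section ConcreteMagnus.
Import GRing.Theory.
Variables (A : comNzRingType) (d : nat).
Variables (f : 'I_d -> 'I_d -> 'I_d -> A) (h : 'I_d -> 'I_d -> A).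
Local Open Scope ring_scope.

Definition outer (u v : 'rV[A]_d) : 'M[A]_d := \matrix_(i, j) (u ord0 i * v ord0 j).

Definition contract12 (u : 'rV[A]_d) (b : 'M[A]_d) : A :=
  \sum_i \sum_j \sum_l u ord0 i * b j l * f i j l.

Definition contract21 (b : 'M[A]_d) (u : 'rV[A]_d) : A :=
  \sum_i \sum_j \sum_l b i j * u ord0 l * f i j l.

Definition contract11 (u v : 'rV[A]_d) : A := \sum_i \sum_j u ord0 i * v ord0 j * h i j.

Lemma outerD : biadditive outer.
Proof. by split=> *; apply/matrixP => i j; rewrite !mxE ?mulrDl ?mulrDr; ring. Qed.

Lemma contract12D : biadditive contract12.
Proof.
split=> *; rewrite /contract12; do 3![rewrite -big_split /=; apply: eq_bigr => ? _];
  by rewrite mxE; ring.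
Qed.

Lemma contract21D : biadditive contract21.
Proof.
split=> *; rewrite /contract21; do 3![rewrite -big_split /=; apply: eq_bigr => ? _];
  by rewrite mxE; ring.
Qed.

Lemma contract11D : biadditive contract11.
Proof.
split=> *; rewrite /contract11; do 2![rewrite -big_split /=; apply: eq_bigr => ? _];
  by rewrite mxE; ring.
Qed.

Lemma contractA u v w : contract21 (outer u v) w = contract12 u (outer v w).
Proof. by do 3![apply: eq_bigr => ? _]; rewrite !mxE; ring. Qed.

(** The truncated tensor algebra on A^d, with its degree 3 part pushed to A along the functional [f]
    on words of length three, and with the bilinear form [h] as shift. *)
Definition concrete_magnus : magnus_data :=
  MagnusData outerD contract12D contract21D contract11D contractA.

Lemma sum_delta (i : 'I_d) (g : 'I_d -> A) : \sum_j (j == i)%:R * g j = g i.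
Proof.
rewrite (bigD1 i) //= eqxx mul1r big1 ?addr0 // => j /negbTE->.
exact: mul0r.
Qed.

Local Notation delta i := (delta_mx ord0 i : 'rV[A]_d).

Lemma contract12_delta i j l : contract12 (delta i) (outer (delta j) (delta l)) = f i j l.
Proof.
rewrite /contract12 -[RHS](sum_delta i (fun a => f a j l)); apply: eq_bigr => a _.
rewrite -(sum_delta j (fun b => f a b l)) mulr_sumr; apply: eq_bigr => b _.
rewrite -(sum_delta l (f a b)) !mulr_sumr; apply: eq_bigr => c _.
by rewrite !mxE !eqxx /=; ring.
Qed.

Lemma contract21_delta i j l : contract21 (outer (delta i) (delta j)) (delta l) = f i j l.
Proof. by rewrite contractA contract12_delta. Qed.

Lemma contract11_delta i j : contract11 (delta i) (delta j) = h i j.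
Proof.
rewrite /contract11 -[RHS](sum_delta i (fun a => h a j)); apply: eq_bigr => a _.
rewrite -(sum_delta j (h a)) !mulr_sumr; apply: eq_bigr => b _.
by rewrite !mxE !eqxx /=; ring.
Qed.

Lemma contract12_torsion n : (forall i j l, f i j l *+ n = 0) ->
  forall u b, contract12 u b *+ n = 0.
Proof.
move=> fn u b; rewrite /contract12 -sumrMnl big1 // => i _.
rewrite -sumrMnl big1 // => j _; rewrite -sumrMnl big1 // => l _.
by rewrite -mulrnAr fn mulr0.
Qed.

Lemma contract21_torsion n : (forall i j l, f i j l *+ n = 0) ->
  forall b u, contract21 b u *+ n = 0.
Proof.
move=> fn b u; rewrite /contract21 -sumrMnl big1 // => i _.
rewrite -sumrMnl big1 // => j _; rewrite -sumrMnl big1 // => l _.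
by rewrite -mulrnAr fn mulr0.
Qed.

End ConcreteMagnus.

Section PrimeSquare.
Import GRing.Theory.
Variable p : nat.
Hypothesis p_pr : prime p.
Local Open Scope ring_scope.
Local Notation A := 'Z_(p ^ 2).

Let p2_gt1 : (1 < p ^ 2)%N.
Proof. by rewrite -(exp1n 2) ltn_exp2r ?prime_gt1. Qed.

(** The embedding of F_p onto the ideal generated by p. Degree 3 lives in Z / p^2 so that the shift
    can take values whose p-fold multiple is nonzero. *)
Definition times_p (x : 'F_p) : A := (p * x)%:R.

Lemma times_pE x : times_p x = (x : nat)%:R *+ p.
Proof. by rewrite /times_p mulnC mulrnA. Qed.

Lemma times_pD x y : times_p (x + y) = times_p x + times_p y.
Proof.
have -> : times_p (x + y) = (p * ((x + y) %% p)%N)%:R.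
  by congr (p * (_ %% _)%N)%:R; exact: Fp_cast.
by rewrite /times_p -natrD -mulnDr muln_modr mulnn Zp_nat_mod.
Qed.

Lemma pp_Zp (x : A) : x *+ p *+ p = 0.
Proof. by rewrite -mulrnA -mulr_natr mulnn pchar_Zp // mulr0. Qed.

Lemma times_p_torsion x : times_p x *+ p = 0.
Proof. by rewrite times_pE pp_Zp. Qed.

Lemma times_p_eq0 x : times_p x = 0 -> x = 0.
Proof.
move=> /(congr1 (fun y : A => y : nat)); rewrite /times_p val_Zp_nat // modn_small.
  by move=> /eqP; rewrite muln_eq0 eqn0Ngt prime_gt0 //= => /eqP x0; apply: val_inj.
rewrite expnS expn1 ltn_pmul2l ?prime_gt0 //.
by have := ltn_ord x; rewrite [X in (_ < X)%N]Fp_cast.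
Qed.

End PrimeSquare.

(** In class two the defect is [y, x] to the power 'C(p, 2), a multiple of p for odd p, and
    commutators have exponent p. *)
Lemma special_expM (p : nat) (H : finGroupType) (x y : H) :
  prime p -> odd p -> special_pgroup p H -> (x * y) ^+ p = x ^+ p * y ^+ p.
Proof.
move=> p_pr p_odd specialH; have yxC := derived_central specialH (comm_derived y x).
rewrite expMg_Rmul; [|exact/commute_sym|exact/commute_sym].
by rewrite bin2odd // expgnA (derived_exp p_pr specialH (comm_derived y x)) expg1n mulg1.
Qed.

(** * The Magnus-type group attached to a functional on T *)

Section Model.
Import GRing.Theory.
Variables (p d : nat) (H : finGroupType).
Hypothesis p_pr : prime p.
Hypothesis p_odd : odd p.
Hypothesis specialH : special_pgroup p H.
Local Notation H' := (derived H).
Local Notation T := (tensor (subg_of H') (coset_of H')).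
Local Notation sc x y := (subcomm x y).
Local Notation co := (coset_hom H).
Variable e : 'I_d -> H.
Hypothesis gen_e : generates e.
Variable v : 'I_d -> {multiplicative coset_of H' -> 'F_p}.
Hypothesis v_dual : dual_family (fun i => co (e i)) v.
Variable l : {multiplicative T -> 'F_p}.
Hypothesis l_Psi2 : forall t, Psi2_image t -> l t = 1.
Hypothesis l_power : forall t, power_tensors H p t -> l t = 1.

Definition lcomm i j m : 'F_p := l (tens (sc (e i) (e j)) (co (e m))).

Lemma functionalM t u : l (t * u) = (l t + l u)%R. Proof. exact: gmulfM. Qed.
Lemma functionalV t : l t^-1 = (- l t)%R. Proof. exact: gmorphV. Qed.

Lemma lcommC i j m : (lcomm j i m = - lcomm i j m)%R.
Proof.
rewrite /lcomm -subcommV; have /= -> := gmorphV (tensl _ (co (e m))) (sc (e i) (e j)).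
exact: functionalV.
Qed.

Lemma lcommxx i m : lcomm i i m = 0%R.
Proof. by rewrite /lcomm subcommxx tens1l gmorph1. Qed.

Lemma lcomm_jacobi i j m : (lcomm i j m + lcomm m i j + lcomm j m i = 0)%R.
Proof.
rewrite /lcomm -!functionalM; apply: l_Psi2.
exact: (psi_form_Psi2_image specialH (e i) (e j) (e m)).
Qed.

Definition lpower x y : 'F_p := l (tens (subg H' (x ^+ p)) (co y)).

Lemma lpowerMl x x' y : lpower (x * x') y = (lpower x y + lpower x' y)%R.
Proof.
rewrite /lpower (special_expM x x' p_pr p_odd specialH) subgM ?exp_derived //.
by rewrite tensMl functionalM.
Qed.

Lemma lpowerMr x y y' : lpower x (y * y') = (lpower x y + lpower x y')%R.
Proof. by rewrite /lpower gmulfM tensMr functionalM. Qed.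

Lemma lpowerxx x : lpower x x = 0%R.
Proof. by rewrite /lpower l_power //; apply: sub_generated; exists x. Qed.

Lemma lpowerC x y : (lpower y x = - lpower x y)%R.
Proof.
apply/eqP; rewrite -addr_eq0; have := lpowerxx (x * y).
by rewrite lpowerMl !lpowerMr !lpowerxx add0r addr0 addrC => ->.
Qed.

(* A functional on words of length three taking the value lcomm i j m on the  *)
(* bracket [[i, j], m].  It is supported on the words whose first letter is   *)
(* strictly the least, and on the words i m m; no division by 3 is involved,  *)
(* so p = 3 is allowed.                                                       *)
Definition word_coef (i j m : 'I_d) : 'F_p :=
  if ((i < j) && (i < m) || (j == m :> nat))%N then lcomm i j m else 0%R.

(** The four signs are those of the expansion [[i, j], m] = ijm - jim - mij + mji; the rest is a
    case analysis on the order of the letters. *)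
Lemma word_coef_bracket i j m :
  (word_coef i j m - word_coef j i m - word_coef m i j + word_coef m j i = lcomm i j m)%R.
Proof.
have J := lcomm_jacobi i j m.
have {J} J : (lcomm j m i = - lcomm i j m - lcomm m i j)%R.
  transitivity ((lcomm i j m + lcomm m i j + lcomm j m i) - lcomm i j m - lcomm m i j)%R.
    by ring.
  by rewrite J; ring.
rewrite /word_coef (lcommC i j) (lcommC j m i) J.
case: (ltngtP i j) => [ij|ji|/val_inj ij]; case: (ltngtP j m) => [jm|mj|/val_inj jm];
  case: (ltngtP i m) => [im|mi|/val_inj im] //=; subst; rewrite ?lcommxx ?ltnn //; try ring;
  try by [have := ltn_trans ij jm; rewrite ltnNge ltnW
         |have := ltn_trans mj ji; rewrite ltnNge ltnW].
Qed.

Local Notation A := 'Z_(p ^ 2).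

Definition cube_coef i j m : A := times_p (word_coef i j m).

(** The upper triangular half of the alternating form [lpower] on the generators, lifted to Z / p^2
    by representatives; the choice of lift disappears after multiplication by p. *)
Definition square_coef (i j : 'I_d) : A :=
  if (i < j)%N then (lpower (e i) (e j) : nat)%:R%R else 0%R.

Let times_p0 : times_p (0%R : 'F_p) = 0%R. Proof. by rewrite /times_p muln0. Qed.

Let times_pN (x : 'F_p) : (times_p (- x) = - times_p x)%R.
Proof. by apply/eqP; rewrite -addr_eq0 -times_pD // addNr times_p0. Qed.

Lemma cube_coef_bracket i j m :
  (cube_coef i j m - cube_coef j i m - cube_coef m i j + cube_coef m j i
    = times_p (lcomm i j m))%R.
Proof. by rewrite -word_coef_bracket !times_pD // !times_pN. Qed.

Lemma square_coef_bracket i j :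
  ((square_coef i j - square_coef j i) *+ p = times_p (lpower (e i) (e j)))%R.
Proof.
rewrite /square_coef; case: (ltngtP i j) => [ij|ji|/val_inj->].
- by rewrite subr0 times_pE.
- by rewrite sub0r mulNrn -times_pE // -times_pN -lpowerC.
by rewrite subrr mul0rn lpowerxx times_p0.
Qed.

Local Notation D := (concrete_magnus cube_coef square_coef).

Let md12p u b : (md12 (m := D) u b *+ p = 0)%R.
Proof. by apply: contract12_torsion => *; exact: times_p_torsion. Qed.

Let md21p b u : (md21 (m := D) b u *+ p = 0)%R.
Proof. by apply: contract21_torsion => *; exact: times_p_torsion. Qed.

Let md_shiftp u w : (md_shift (m := D) u w *+ p *+ p = 0)%R.
Proof. exact: pp_Zp. Qed.

Local Notation F := (free_group 'I_d).

Lemma generates_free_gen (X : choiceType) : generates (@free_gen X).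
Proof.
move=> M sM Mg; apply: free_ind => [|x a Ma|x a Ma]; first by case: sM.
  exact: is_subgroupM (Mg x) Ma.
by apply: is_subgroupM Ma => //; apply: is_subgroupV.
Qed.

Variable psi : {multiplicative F -> H}.
Hypothesis psi_gen : forall i, psi (free_gen i) = e i.
Variable rho : {multiplicative F -> magnus D}.
Hypothesis rho_gen : forall i, rho (free_gen i) = (delta_mx ord0 i, 0%R, 0%R).

Definition lpair (a : subg_of H') (b : coset_of H') : A := times_p (l (tens a b)).

Lemma lpairMl a a' b : lpair (a * a') b = (lpair a b + lpair a' b)%R.
Proof. by rewrite /lpair tensMl functionalM times_pD. Qed.

Lemma lpairMr a b b' : lpair a (b * b') = (lpair a b + lpair a b')%R.
Proof. by rewrite /lpair tensMr functionalM times_pD. Qed.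

Let bracket_comm u w z : md3 D :=
  (md21 (md11 u w - md11 w u) z - md12 z (md11 u w - md11 w u))%R.

(* Both sides are homomorphisms in each of u, w and z. *)
Lemma magnus_bracket_comm u w z :
  magnus_bracket (rho [~ u, w]) (rho z) = lpair (sc (psi u) (psi w)) (co (psi z)).
Proof.
rewrite gmorphR magnus_bracketR deg2R -/(bracket_comm _ _ _).
pose r x := deg1 (rho x).
have rM x y : r (x * y) = (r x + r y)%R by rewrite /r gmulfM.
have gen := @generates_free_gen 'I_d.
pose B x y z : A := bracket_comm (r x) (r y) (r z).
pose C x y z := lpair (sc (psi x) (psi y)) (co (psi z)).
have B1 x x' y t : B (x * x') y t = (B x y t + B x' y t)%R.
  by rewrite /B /bracket_comm rM !magnus_biaddE /=; ring.
have B2 x y y' t : B x (y * y') t = (B x y t + B x y' t)%R.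
  by rewrite /B /bracket_comm rM !magnus_biaddE /=; ring.
have B3 x y t t' : B x y (t * t') = (B x y t + B x y t')%R.
  by rewrite /B /bracket_comm rM !magnus_biaddE /=; ring.
have C1 x x' y t : C (x * x') y t = (C x y t + C x' y t)%R.
  by rewrite /C gmulfM (subcommMl specialH) lpairMl.
have C2 x y y' t : C x (y * y') t = (C x y t + C x y' t)%R.
  by rewrite /C gmulfM (subcommMr specialH) lpairMl.
have C3 x y t t' : C x y (t * t') = (C x y t + C x y t')%R.
  by rewrite /C !gmulfM lpairMr.
rewrite -/(B u w z) -/(C u w z).
apply: (eq_hom (f := mult_hom (fun x x' => B1 x x' w z))
               (g := mult_hom (fun x x' => C1 x x' w z)) gen) => i /=.
apply: (eq_hom (f := mult_hom (fun y y' => B2 (free_gen i) y y' z))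
               (g := mult_hom (fun y y' => C2 (free_gen i) y y' z)) gen) => j /=.
apply: (eq_hom (f := mult_hom (B3 (free_gen i) (free_gen j)))
               (g := mult_hom (C3 (free_gen i) (free_gen j))) gen) => m /=.
rewrite /B /C /r /bracket_comm !rho_gen /deg1 /= !psi_gen.
rewrite (biaddDl (contract21D cube_coef)) (biaddNl (contract21D cube_coef)).
rewrite (biaddDr (contract12D cube_coef)) (biaddNr (contract12D cube_coef)).
rewrite !contract21_delta !contract12_delta.
by rewrite [RHS](esym (cube_coef_bracket i j m)); ring.
Qed.

(** Both sides are additive in w and z, the right one because the p-th power map of H is a
    homomorphism; on generators the shift was chosen to give equality. *)
Lemma magnus_bracket_pow w z :
  magnus_bracket (rho (w ^+ p)) (rho z) = lpair (subg H' (psi w ^+ p)) (co (psi z)).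
Proof.
rewrite gmorphX (magnus_bracketX md12p md21p _ _ p_odd).
pose r x := deg1 (rho x).
have rM x y : r (x * y) = (r x + r y)%R by rewrite /r gmulfM.
have gen := @generates_free_gen 'I_d.
pose B x z : A := ((md_shift (m := D) (r x) (r z) - md_shift (m := D) (r z) (r x)) *+ p)%R.
pose C x z := lpair (subg H' (psi x ^+ p)) (co (psi z)).
have B1 x x' t : B (x * x') t = (B x t + B x' t)%R.
  by rewrite /B rM !magnus_biaddE /= -mulrnDl; congr (_ *+ _)%R; ring.
have B2 x t t' : B x (t * t') = (B x t + B x t')%R.
  by rewrite /B rM !magnus_biaddE /= -mulrnDl; congr (_ *+ _)%R; ring.
have C1 x x' t : C (x * x') t = (C x t + C x' t)%R.
  by rewrite /C gmulfM (special_expM _ _ p_pr p_odd specialH) subgM ?exp_derived // lpairMl.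
have C2 x t t' : C x (t * t') = (C x t + C x t')%R.
  by rewrite /C !gmulfM lpairMr.
rewrite -/(B w z) -/(C w z).
apply: (eq_hom (f := mult_hom (fun x x' => B1 x x' z))
               (g := mult_hom (fun x x' => C1 x x' z)) gen) => i /=.
apply: (eq_hom (f := mult_hom (B2 (free_gen i)))
               (g := mult_hom (C2 (free_gen i))) gen) => j /=.
rewrite /B /C /r !rho_gen /deg1 /= !psi_gen !contract11_delta.
exact: square_coef_bracket.
Qed.

End Model.

Section PreimageDerived.
Import GRing.Theory.
Variables (p d : nat) (H : finGroupType).
Hypothesis p_pr : prime p.
Hypothesis specialH : special_pgroup p H.
Local Notation H' := (derived H).
Local Notation co := (coset_hom H).
Variable e : 'I_d -> H.
Variable v : 'I_d -> {multiplicative coset_of H' -> 'F_p}.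
Hypothesis v_dual : dual_family (fun i => co (e i)) v.
Local Notation F := (free_group 'I_d).
Variable psi : {multiplicative F -> H}.
Hypothesis psi_gen : forall i, psi (free_gen i) = e i.

(* The quotient of the free group by these elements is elementary abelian on  *)
(* d generators, hence isomorphic to H / H'.                                  *)
Lemma preimage_derived_ind (M : set F) :
    is_subgroup M -> (forall w, M (w ^+ p)) -> (forall u w, M [~ u, w]) ->
  forall s, psi s \in H' -> M s.
Proof.
move=> sM Mp Mc s sH.
pose A0 : set F := [set u | (exists w, u = w ^+ p) \/ exists u1 u2, u = [~ u1, u2]].
suff : normal_closure A0 s.
  apply: generated_min => // _ [a [[w ->]|[u1 [u2 ->]]] [g ->]].
    by rewrite conjXg; apply: Mp.
  by rewrite conjRg; apply: Mc.
apply/quotg_proj_eq1.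
pose q : {multiplicative F -> quotg A0} := quotg_proj A0.
have q_onto u : exists x, q x = u by exists (repr u); exact: quotg_projK.
have qC i j : commute (q (free_gen i)) (q (free_gen j)).
  apply/commgP/eqP; rewrite -(gmorphR q); apply: quotg_proj_rel.
  by right; exists (free_gen i), (free_gen j).
have qp i : q (free_gen i) ^+ p = 1.
  by rewrite -gmorphX; apply: quotg_proj_rel; left; exists (free_gen i).
have [f fc] := elementary_hom p_pr (fun i j : 'I_#|'I_d| => qC (enum_val i) (enum_val j))
  (fun i => qp (enum_val i)).
have [g [gc _]] := dual_family_coordinates v_dual.
have := eq_hom (f := f \o g \o co \o psi) (g := q) (@generates_free_gen 'I_d).
move=> /(_ _ s) <- => [|i] /=.
  by move/coset_hom1: sH => /= ->; rewrite !gmorph1.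
by rewrite psi_gen gc fc enum_rankK.
Qed.

End PreimageDerived.

(** * Detecting functionals on the Schur multiplier *)

Section KernelBeta.
Import GRing.Theory.
Variables (p d : nat) (H : finGroupType).
Hypothesis p_pr : prime p.
Hypothesis p_odd : odd p.
Hypothesis specialH : special_pgroup p H.
Local Notation H' := (derived H).
Local Notation T := (tensor (subg_of H') (coset_of H')).
Local Notation co := (coset_hom H).
Variable e : 'I_d -> H.
Hypothesis gen_e : generates e.
Variable v : 'I_d -> {multiplicative coset_of H' -> 'F_p}.
Hypothesis v_dual : dual_family (fun i => co (e i)) v.
Variable l : {multiplicative T -> 'F_p}.
Hypothesis l_Psi2 : forall t, Psi2_image t -> l t = 1.
Hypothesis l_power : forall t, power_tensors H p t -> l t = 1.
Local Notation F := (free_group 'I_d).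
Local Notation A := 'Z_(p ^ 2).

(** The function is the degree 3 part in the Magnus-type group. Over H' it is additive, and on
    commutators [s, z] it computes [l], so it vanishes on [R, F] while recovering [l t] from a
    representative of [beta phi t]. *)
Lemma free_level_function (psi : {multiplicative F -> H}) :
    (forall i, psi (free_gen i) = e i) ->
  exists c : F -> A,
    [/\ c 1 = 0%R,
        forall s t, psi s \in H' -> psi t \in H' -> c (s * t) = (c s + c t)%R
      & forall s z, psi s \in H' -> c [~ s, z] = lpair l (subg H' (psi s)) (co (psi z))].
Proof.
move=> psi_gen.
pose D := concrete_magnus (cube_coef e l) (square_coef e l).
have md12p u b : (md12 (m := D) u b *+ p = 0)%R.
  by apply: contract12_torsion => *; exact: times_p_torsion.
have md21p b u : (md21 (m := D) b u *+ p = 0)%R.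
  by apply: contract21_torsion => *; exact: times_p_torsion.
have md_shiftp u w : (md_shift (m := D) u w *+ p *+ p = 0)%R by exact: pp_Zp.
have [rho rho_gen] := free_lift (fun i : 'I_d => (delta_mx ord0 i, 0%R, 0%R) : magnus D).
(* The three properties go through one induction over p-th powers and commutators: additivity of the
   bracket needs p-divisibility, and additivity of the right side needs membership in H'. *)
have main s : psi s \in H' -> psi s \in H' /\ p_divisible p (rho s) /\
    forall z, magnus_bracket (rho s) (rho z) = lpair l (subg H' (psi s)) (co (psi z)).
  pose M : set F := [set s | psi s \in H' /\ p_divisible p (rho s) /\
    forall z, magnus_bracket (rho s) (rho z) = lpair l (subg H' (psi s)) (co (psi z))].
  have lpair1 b : lpair l 1 b = 0%R by rewrite /lpair tens1l gmorph1 /times_p muln0.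
  move=> sH; apply: (preimage_derived_ind p_pr v_dual psi_gen (M := M)) sH.
  - split=> [|x y /= [xH [xp xE]] [yH [yp yE]]]; rewrite /M /=.
      rewrite !gmorph1 group1; split=> //; split=> [|z].
        by exists 0%R; rewrite mul0rn.
      by rewrite subg_derived1 lpair1 /magnus_bracket !magnus_biaddE !subrr addr0.
    have xyp : p_divisible p (rho (x * y^-1)).
      by rewrite gmulfM gmorphV; apply: p_divisibleM => //; apply: p_divisibleV.
    have xyH : psi (x * y^-1) \in H' by rewrite gmulfM gmorphV groupM ?groupV.
    split=> //; split=> // z; apply: (@addIr _ (magnus_bracket (rho y) (rho z))).
    rewrite -(magnus_bracketDl md12p md21p) // -gmulfM mulgVK xE yE -lpairMl //.
    by rewrite -subgM // -gmulfM mulgVK.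
  - move=> w; split; first by rewrite gmorphX exp_derived.
    split; first by rewrite gmorphX; exact: p_divisibleX.
    move=> z; rewrite (gmorphX psi).
    exact: (magnus_bracket_pow p_pr p_odd specialH l_power psi_gen rho_gen).
  move=> u w; split; first by rewrite gmorphR comm_derived.
  split; first by rewrite gmorphR; exact: p_divisibleR.
  move=> z; rewrite (magnus_bracket_comm p_pr specialH l_Psi2 psi_gen rho_gen).
  by rewrite /subcomm gmorphR.
exists (fun s => deg3 (rho s)).
split=> [|s t /main[_ [sp _]] /main[_ [tp _]]|s z /main[_ [sp sE]]].
- by rewrite gmorph1.
- by rewrite gmulfM (deg3M_divisible md12p md21p md_shiftp).
by rewrite gmorphR (deg3R md12p md21p) // sE.
Qed.

Variables (X : choiceType) (phi : {multiplicative free_group X -> H}).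
Hypothesis phi_onto : forall h, exists x, phi x = h.

Lemma ker_beta_functional t : beta phi t = 1 -> l t = 1.
Proof.
have [psi psi_gen] := free_lift e.
have psi_onto h : exists x, psi x = h.
  suff [x _ <-] : range psi h by exists x.
  apply: gen_e; first by apply: is_subgroup_image; split.
  by move=> i; exists (free_gen i).
(* The given presentation has arbitrary generators X while the model lives on d generators; [r0]
   lifts [phi] through [psi] and transfers the function [c]. *)
have /choice[s0 s0E] : forall x : X, exists y, psi y = phi (free_gen x) by move=> x.
have [r0 r0E] := free_lift s0.
have r0psi x : psi (r0 x) = phi x.
  apply: (eq_hom (f := psi \o r0) (g := phi) (@generates_free_gen X)) => y /=.
  by rewrite r0E s0E.
have [c [c1 cM cR]] := free_level_function psi_gen.
have N1 : 1 \in H' by exact: group1.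
(* Triviality under [phi] is carried along because [c] is additive only over H'. This subgroup
   contains the normal closure of [R, F]. *)
pose K : set (free_group X) := [set w | phi w = 1 /\ c (r0 w) = 0%R].
have cV s : psi s \in H' -> c s^-1 = (- c s)%R.
  move=> sH; apply/eqP; rewrite -addr_eq0 addrC -cM ?mulgV ?c1 //.
  by rewrite gmorphV groupV.
have lpair1 b : lpair l 1 b = 0%R by rewrite /lpair tens1l gmorph1 /times_p muln0.
have sK : is_subgroup K.
  split=> [|x y /= [x1 cx] [y1 cy]]; rewrite /K /= ?gmorph1 //.
  rewrite !gmulfM !gmorphV x1 y1 mulgV; split=> //.
  by rewrite cM ?cV ?gmorphV ?r0psi ?x1 ?y1 ?groupV // cx cy subr0.
have RK : normal_closure (RF phi) `<=` K.
  apply: generated_min => // _ [a Ra [g ->]].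
  have [a1 ca] : K a.
    move: a Ra; apply: generated_min => // _ [r /= r1 [z _ ->]]; split.
      by rewrite gmorphR r1 comm1g.
    by rewrite gmorphR cR ?r0psi ?r1 // subg_derived1 lpair1.
  split; first by rewrite gmorphJ a1 conj1g.
  have -> : a ^ g = a * [~ a, g] by rewrite mulVKg.
  rewrite gmulfM gmorphR cM ?r0psi ?a1 ?gmorphR ?comm_derived //.
  by rewrite cR ?r0psi ?a1 // subg_derived1 lpair1 ca addr0.
have bh := beta_is_beta specialH phi_onto.
pose q : {multiplicative free_group X -> quotg (RF phi)} := quotg_proj (RF phi).
(* Every [beta phi t] has a representative on which [c] takes the value p l(t). If [beta phi t] is
   trivial, that representative lies in K, and [times_p] is injective. *)
suff [w [w1 cw bw]] : exists w, [/\ phi w = 1, c (r0 w) = times_p (l t)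
    & beta phi t = q w].
  move=> bt; have /RK[_] : normal_closure (RF phi) w by apply/quotg_proj_eq1; rewrite -bw.
  by rewrite cw; exact: times_p_eq0.
move: t; apply: tensor_subgroup_ind => [|a b].
  split=> [|t u /= [w [w1 cw bw]] [w' [w'1 cw' bw']]].
    exists 1; rewrite !gmorph1 c1 /times_p muln0; split=> //.
    exact: (gmorph1 (mult_hom (proj1 bh))).
  exists (w * w'^-1); split.
  - by rewrite gmulfM gmorphV w1 w'1 mulgV.
  - rewrite !gmulfM !gmorphV cM ?cV ?gmorphV ?r0psi ?w1 ?w'1 ?groupV // cw cw'.
    apply/eqP; rewrite subr_eq -times_pD //; apply/eqP; congr times_p.
    exact/esym/(mulgVK (l u)).
  - have bV : beta phi u^-1 = (beta phi u)^-1 := gmorphV (mult_hom (proj1 bh)) u.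
    rewrite (proj1 bh) bV bw bw' [RHS]gmulfM; congr (_ * _).
    exact/esym/(gmorphV q).
have [x xa] := phi_onto (sgval a); have [z zb] := phi_onto (fingroup.repr b).
have xH : phi x \in H' by rewrite xa; exact: subgP.
exists [~ x, z]; split; first exact: (phi_commg specialH z xH).
  rewrite gmorphR cR ?r0psi // /lpair xa sgvalK zb.
  by congr (times_p (l (tens a _))); exact: coset_reprK.
have := betaE specialH phi_onto z xH; rewrite xa sgvalK zb => bE.
rewrite -[RHS]bE; congr (beta phi (tens a _)); exact/esym/coset_reprK.
Qed.

End KernelBeta.

(** * Groups of class two and the presentation of H *)

Section ClassTwo.
Variables (G : groupType) (I : Type) (c : I -> G).
Hypothesis gen : generates c.
Local Notation central x := (forall g, commute x g).

Lemma centralM (x y : G) : central x -> central y -> central (x * y).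
Proof. by move=> xC yC g; apply/commute_sym/commuteM; apply/commute_sym. Qed.

Lemma centralV (x : G) : central x -> central x^-1.
Proof. by move=> xC g; apply/commute_sym/commuteV/commute_sym. Qed.

Lemma comm_divl_central (x y z : G) : central [~ x, z] -> central [~ y, z] ->
  [~ x * y^-1, z] = [~ x, z] * [~ y, z]^-1.
Proof.
move=> xC yC; rewrite commMl_central //; congr (_ * _).
apply: (mulgI [~ y, z]); rewrite mulgV -(commMl_central _ yC) mulgV.
exact: comm1g.
Qed.

Lemma is_subgroup_comm_central (z : G) : is_subgroup [set x | central [~ x, z]].
Proof.
split=> [|x y /= xC yC] /=; first by rewrite comm1g => g; apply/commute_sym/commute1.
by rewrite comm_divl_central //; apply: centralM => //; apply: centralV.
Qed.

Lemma is_subgroup_commute (z : G) : is_subgroup [set x | commute z x].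
Proof.
split=> [|x y /= zx zy] /=; first exact: commute1.
by apply: commuteM => //; apply: commuteV.
Qed.

Hypothesis cC : forall i j t, commute [~ c i, c j] (c t).

(** First the centralizer of [c i, c j] contains the generators, hence everything; then each
    argument is freed in turn, inversion exchanging the two. *)
Lemma class2_comm_central (x y : G) : central [~ x, y].
Proof.
have cc i j : central [~ c i, c j].
  by apply: gen; [exact: is_subgroup_commute | exact: cC].
apply: (gen (is_subgroup_comm_central y)) => i /=.
rewrite -invgR; apply: centralV.
apply: (gen (is_subgroup_comm_central (c i))) => j /=.
exact: cc.
Qed.

(** The collection formula of class two, for arbitrary groups since the presented group is not known
    to be finite. *)
Lemma class2_expM (x y : G) n : (x * y) ^+ n = x ^+ n * y ^+ n * [~ y, x] ^+ 'C(n, 2).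
Proof.
have yxC := class2_comm_central y x.
have yXx m : [~ y ^+ m, x] = [~ y, x] ^+ m.
  elim: m => [|m IH]; first exact: comm1g.
  by rewrite !expgS commMl_central ?IH.
elim: n => [|n IH]; first by rewrite !mulg1.
have powC m g : commute ([~ y, x] ^+ m) g by apply/commute_sym/commuteX/commute_sym.
have E : x ^+ n * y ^+ n * (x * y) = x ^+ n.+1 * y ^+ n.+1 * [~ y, x] ^+ n.
  rewrite -(mulgA (x ^+ n)) (mulgA (y ^+ n)) (commgC (y ^+ n)) yXx !expgSr !mulgA.
  by rewrite -(mulgA _ ([~ y, x] ^+ n) y) (powC n y) !mulgA.
rewrite binS bin1 expgnDr expgSr IH -(mulgA _ _ (x * y)) (powC _ (x * y)) mulgA E -mulgA.
by congr (_ * _); exact: powC.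
Qed.

Variable p : nat.
Hypothesis p_odd : odd p.
Hypothesis cp : forall i, c i ^+ p = 1.
Hypothesis ccp : forall i j, [~ c i, c j] ^+ p = 1.

Lemma class2_comm_exp (x y : G) : [~ x, y] ^+ p = 1.
Proof.
have sub (z : G) : is_subgroup [set x : G | [~ x, z] ^+ p = 1].
  split=> [|u w /= up wp] /=; first by rewrite comm1g expg1n.
  rewrite (comm_divl_central (class2_comm_central u z) (class2_comm_central w z)).
  rewrite expgMn ?expVgn ?up ?wp ?invg1 ?mulg1 //.
  exact: class2_comm_central.
apply: (gen (sub y)) => i /=; rewrite -invgR expVgn.
rewrite (gen (sub (c i)) (fun j => ccp j i) y).
exact: invg1.
Qed.

Lemma class2_exp (x : G) : x ^+ p = 1.
Proof.
move: x; apply: (gen (M := [set x | x ^+ p = 1])) => //.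
split=> [|x y /= xp yp] /=; first exact: expg1n.
rewrite class2_expM xp expVgn yp invg1 bin2odd // expgnA class2_comm_exp expg1n.
by rewrite !mulg1.
Qed.

End ClassTwo.

Section Presentation.
Variables (p d : nat) (H : finGroupType).
Hypothesis p_pr : prime p.
Hypothesis p_odd : odd p.
Hypothesis specialH : special_pgroup p H.
Local Notation H' := (derived H).
Variable e : 'I_d -> H.
Hypothesis gen_e : generates e.
Variable v : 'I_d -> {multiplicative coset_of H' -> 'F_p}.
Hypothesis v_dual : dual_family (fun i => coset_hom H (e i)) v.
Variable k : pairs d -> {multiplicative subg_of H' -> 'F_p}.
Hypothesis k_dual :
  dual_family (fun x : pairs d => subcomm (e (\val x).1) (e (\val x).2)) k.
Hypothesis ep : forall i, e i ^+ p = 1.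

Lemma special_exp (x : H) : x ^+ p = 1.
Proof.
apply: (class2_exp gen_e _ p_odd ep) => [i j t|i j].
  exact: (derived_central specialH (comm_derived _ _)).
exact: (derived_exp p_pr specialH (comm_derived _ _)).
Qed.

Lemma special_exponentE : exponent (whole H) = p.
Proof.
have : (exponent (whole H) %| p)%N by apply/exponentP => x _; exact: special_exp.
case/primeP: (p_pr) => _ /[apply] /orP[/eqP e1|/eqP //].
case: specialH => _ /negP[]; apply: (abelianS _ (abelian1 H)).
have /exponentP E : (exponent (whole H) %| 1)%N by rewrite e1.
by apply/fintype.subsetP => x /E; rewrite expg1 => ->; rewrite group1.
Qed.

Local Notation F := (free_group 'I_d).
Local Notation G := (quotg (class2_relators p d)).

(** The presented group maps onto H; injectivity is the point. The independence of the [e i, e j]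
    provides a homomorphism [tau] from H' back to the presented group, so a word trivial in H is
    already trivial there. *)
Lemma special_isomorphic_presented : isomorphic [set: H] [set: G].
Proof.
pose q : {multiplicative F -> G} := quotg_proj (class2_relators p d).
have q_onto u : exists x, q x = u by exists (repr u); exact: quotg_projK.
have genF := @generates_free_gen 'I_d.
have gen_q : generates (fun i : 'I_d => q (free_gen i)).
  exact: (generates_range genF q_onto).
have [psi psi_gen] := free_lift e.
have psi_onto h : exists x, psi x = h.
  suff [x _ <-] : range psi h by exists x.
  apply: gen_e; first by apply: is_subgroup_image; split.
  by move=> i; exists (free_gen i).
have psi_rel a : class2_relators p d a -> psi a = 1.
  case=> [[t ->]|[i [j ->]]|[i [j [t ->]]]]; first by rewrite gmorphX psi_gen ep.
    by rewrite gmorphX special_exp.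
  rewrite !gmorphR; apply/eqP/commgP.
  exact: (derived_central specialH (comm_derived _ _)).
have [pi piE] := quotg_lift psi_rel.
have cC i j t : commute [~ q (free_gen i), q (free_gen j)] (q (free_gen t)).
  apply/commgP/eqP; rewrite -(gmorphR q (free_gen i)) -(gmorphR q _ (free_gen t)).
  by apply: quotg_proj_rel; apply: Or33; exists i, j, t.
have cp i : q (free_gen i) ^+ p = 1.
  by rewrite -gmorphX; apply: quotg_proj_rel; apply: Or31; exists i.
have ccp i j : [~ q (free_gen i), q (free_gen j)] ^+ p = 1.
  rewrite -(gmorphR q) -gmorphX.
  by apply: quotg_proj_rel; apply: Or32; exists i, j.
have qR x y g : commute [~ q x, q y] g by exact: (class2_comm_central gen_q cC).
have q_central : forall s, psi s \in H' -> forall x, commute (q s) (q x).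
  apply: (preimage_derived_ind p_pr v_dual psi_gen
    (M := [set s | forall x, commute (q s) (q x)])) => [|w x|u w x].
  - split=> [x|s t /= sC tC x] /=; first by rewrite gmorph1; apply/commute_sym/commute1.
    rewrite gmulfM gmorphV; apply/commute_sym/commuteM; first exact/commute_sym.
    exact/commuteV/commute_sym.
  - rewrite gmorphX (class2_exp gen_q cC p_odd cp ccp).
    exact/commute_sym/commute1.
  by rewrite (gmorphR q).
have q_exp x y : [~ q x, q y] ^+ p = 1 by exact: (class2_comm_exp gen_q cC ccp).
have [tau tauE] := commutator_hom p_pr specialH gen_e k_dual psi_onto q_central q_exp.
(* Over H' the projection [q] is [tau] after [psi]: p-th powers are trivial on both sides, and
   commutators agree by the choice of [tau]. *)
have main s : psi s \in H' -> q s = tau (subg H' (psi s)).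
  move=> sH.
  suff [] : psi s \in H' /\ q s = tau (subg H' (psi s)) by [].
  apply: (preimage_derived_ind p_pr v_dual psi_gen
    (M := [set s | psi s \in H' /\ q s = tau (subg H' (psi s))])) sH => [|w|u w].
  - exact: is_subgroup_tau.
  - rewrite /= !gmorphX special_exp group1 subg_derived1 gmorph1.
    by rewrite (class2_exp gen_q cC p_odd cp ccp).
  by rewrite /= tauE gmorphR comm_derived.
apply: (isomorphic_range (f := pi)); last first.
  apply/seteqP; split=> // h _; have [x <-] := psi_onto h.
  by exists (q x) => //; exact: piE.
apply: hom_inj => u; have [w <-] := q_onto u; rewrite piE => w1.
by rewrite main w1 ?group1 // subg_derived1 gmorph1.
Qed.

End Presentation.

(** * Orders and the theorem *)

Section Counting.
Variables (p d : nat) (H : finGroupType).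
Hypothesis p_pr : prime p.
Hypothesis p_odd : odd p.
Hypothesis specialH : special_pgroup p H.
Local Notation H' := (derived H).
Local Notation T := (tensor (subg_of H') (coset_of H')).
Variable e : 'I_d -> H.
Hypothesis gen_e : generates e.
Variable v : 'I_d -> {multiplicative coset_of H' -> 'F_p}.
Hypothesis v_dual : dual_family (fun i => coset_hom H (e i)) v.
Variable k : pairs d -> {multiplicative subg_of H' -> 'F_p}.
Hypothesis k_dual :
  dual_family (fun x : pairs d => subcomm (e (\val x).1) (e (\val x).2)) k.
Variables (X : choiceType) (phi : {multiplicative free_group X -> H}).
Hypothesis phi_onto : forall h, exists x, phi x = h.
Variables (N : nat) (g : {multiplicative T -> elementary_abelian p N})
  (f : {multiplicative elementary_abelian p N -> T}).
Hypothesis gK : cancel g f.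
Hypothesis fK : cancel f g.

Local Notation P := (power_tensors H p).
Local Notation I := (@Psi2_image H).
Local Notation fin A := (finite_part (f @^-1` A)).

Let sP : is_subgroup (f @^-1` P).
Proof. exact/is_subgroup_preimage/is_subgroup_generated. Qed.

Let sI : is_subgroup (f @^-1` I).
Proof. exact: is_subgroup_preimage (is_subgroup_Psi2_image specialH). Qed.

Lemma mem_finite_part n (A : set 'rV['F_p]_n) x : (x \in finite_part A) = `[< A x >].
Proof. by rewrite finset.inE. Qed.

(** A kernel element outside the product of the two subgroups would be separated from it by a
    functional, contrary to [ker_beta_functional]. *)
Lemma ker_betaE : fin (kernel (beta phi)) = (fin I * fin P)%g.
Proof.
have bh := proj1 (beta_is_beta specialH phi_onto).
apply/setP => x; rewrite mem_finite_part; apply/asboolP/mulsgP => [bx|[y z]].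
  pose B : set 'rV['F_p]_N := [set x | exists2 y, I (f y) & exists2 z, P (f z) & x = y * z].
  have sB : is_subgroup B.
    split=> [|_ _ [y Iy [z Pz ->]] [y' Iy' [z' Pz' ->]]].
      by exists 1; [case: sI | exists 1; [case: sP | rewrite mulg1]].
    exists (y * y'^-1); first exact: (proj2 sI).
    exists (z * z'^-1); first exact: (proj2 sP).
    have C (a b : elementary_abelian p N) : commute a b by exact: GRing.addrC.
    by rewrite invgM (C z'^-1) !mulgA -(mulgA y z) (C z) !mulgA.
  have [[y Iy [z Pz xyz]]|nB] := pselect (B x).
    by exists y z => //; rewrite mem_finite_part; apply/asboolP.
  have [l [lB lx]] := separating_functional sB nB.
  have BI y : I (f y) -> B y.
    by move=> Iy; exists y => //; exists 1; [case: sP | rewrite mulg1].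
  have BP y : P (f y) -> B y.
    by move=> Py; exists 1; [case: sI | exists y => //; rewrite mul1g].
  case: lx; rewrite -[x]fK.
  apply: (ker_beta_functional p_pr p_odd specialH gen_e v_dual (l := l \o g) _ _
    phi_onto bx).
    by move=> t It; apply: lB; apply: BI; rewrite gK.
  by move=> t Pt; apply: lB; apply: BP; rewrite gK.
rewrite !mem_finite_part => /asboolP Iy /asboolP Pz ->.
rewrite /kernel /= gmulfM bh.
have /= -> := Psi2_image_ker_beta specialH phi_onto Iy.
by rewrite (power_tensors_ker_beta p_pr specialH phi_onto Pz) mulg1.
Qed.

Lemma mprimeE :
  mprime H p = logn p (#|fin P| %/ #|fin I :&: fin P|).
Proof.
rewrite /mprime !(card_fset_set_coordinates _ gK fK).
congr (logn p (_ %/ #|pred_of_set _|)); apply/setP => x.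
rewrite finset.in_setI !mem_finite_part.
by apply/asboolP/andP => [[Ix Px]|[/asboolP Ix /asboolP Px]]; split=> //; apply/asboolP.
Qed.

Lemma card_ker_beta : #|fin (kernel (beta phi))| = (p ^ ('C(d, 3) + mprime H p))%N.
Proof.
pose GI := Group (finite_part_group_set sI); pose GP := Group (finite_part_group_set sP).
(* The product formula |I P| |I meet P| = |I| |P|, in which |P| / |I meet P| is p^m'. *)
have := mul_cardG GI GP; rewrite -/(fin I) /= -ker_betaE.
have cI := card_Psi2_image p_pr specialH gen_e v_dual k_dual gK fK.
have pP : p.-nat #|fin P| by rewrite card_finite_part // pnatX pnat_id.
have dvd : #|fin I :&: fin P| %| #|fin P| by exact: (cardSg (finset.subsetIr GI GP)).
have IP0 : (0 < #|fin I :&: fin P|)%N by exact: (cardG_gt0 (GI :&: GP)).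
have cP : #|fin P| = (p ^ mprime H p * #|fin I :&: fin P|)%N.
  rewrite mprimeE -p_part part_pnat_id ?divnK //.
  by apply: pnat_dvd pP; exact: dvdn_div.
rewrite cI {1}cP mulnA -expnD => /eqP.
by rewrite eqn_pmul2r // => /eqP <-.
Qed.

(** The index of the intersection in P is a power of p, so its logarithm vanishes exactly when the
    intersection is all of P. *)
Lemma mprime_eq0 : mprime H p = 0%N <-> P `<=` I.
Proof.
rewrite mprimeE.
have pP : p.-nat #|fin P| by rewrite card_finite_part // pnatX pnat_id.
pose GI := Group (finite_part_group_set sI); pose GP := Group (finite_part_group_set sP).
have dvd : #|fin I :&: fin P| %| #|fin P| by exact: (cardSg (finset.subsetIr GI GP)).
have IP0 : (0 < #|fin I :&: fin P|)%N by exact: (cardG_gt0 (GI :&: GP)).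
have pD : p.-nat (#|fin P| %/ #|fin I :&: fin P|).
  by apply: pnat_dvd pP; exact: dvdn_div.
split=> [m0 t Pt|PI].
  have D1 : (#|fin P| %/ #|fin I :&: fin P|)%N = 1%N.
    by rewrite -(part_pnat_id pD) p_part m0.
  have : fin I :&: fin P == fin P.
    rewrite eqEcard finset.subsetIr /=.
    by rewrite -(divnK dvd) D1 mul1n.
  move=> /eqP/setP/(_ (g t)); rewrite finset.in_setI !mem_finite_part /= gK.
  by rewrite (asboolT Pt) andbT => /asboolP.
have -> : fin I :&: fin P = fin P.
  apply/finset.setIidPr/fintype.subsetP => x; rewrite !mem_finite_part => /asboolP Px.
  by apply/asboolP/PI.
by rewrite divnn (cardG_gt0 GP) logn1.
Qed.

Lemma isomorphic_preimage n (A : set T) :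
  isomorphic (f @^-1` A) [set: elementary_abelian p n] ->
  isomorphic A [set: elementary_abelian p n].
Proof.
move=> [h [hM [_ h_inj h_surj]]]; exists (h \o g).
have Ag x : A x -> (f @^-1` A) (g x) by rewrite /= gK.
split=> [x y Ax Ay|] /=; first by rewrite gmulfM hM //; exact: Ag.
split=> [x _ //|x y /set_mem Ax /set_mem Ay /= hxy|y yT].
  apply: (can_inj gK); apply: h_inj => //; apply/mem_set; exact: Ag.
by have [x Ax <-] := h_surj y yT; exists (f x) => //=; rewrite fK.
Qed.

Lemma isomorphic_ker_schur :
  isomorphic (kernel (beta phi)) [set: elementary_abelian p ('C(d, 3) + mprime H p)] /\
  isomorphic (schur_multiplier phi)
    [set: elementary_abelian p (N - ('C(d, 3) + mprime H p))].
Proof.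
pose b := beta_hom specialH phi_onto.
have [kerI rangeI] := isomorphic_kernel_range p_pr (f := b \o f) card_ker_beta.
split; first exact: isomorphic_preimage.
rewrite (schur_multiplierE p_pr specialH gen_e k_dual phi_onto).
suff <- : range (b \o f) = range (beta phi) by [].
apply/seteqP; split=> [_ [x _ <-]|_ [t _ <-]]; first by exists (f x).
by exists (g t) => //=; rewrite gK.
Qed.

(** It ensures that the truncated subtraction in the rank of the Schur multiplier is a genuine
    one. *)
Lemma mprime_bound : ('C(d, 3) + mprime H p <= N)%N.
Proof.
rewrite -(leq_exp2l _ _ (prime_gt1 p_pr)) -card_ker_beta.
apply: leq_trans (max_card _) _.
by rewrite card_mx mul1n card_Fp.
Qed.

Lemma mprime0_iff :
  mprime H p = 0%N <-> exponent (whole H) = p.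
Proof.
split=> [/mprime_eq0 PI|expH].
  apply: (special_exponentE p_pr p_odd specialH gen_e).
  exact: (power_tensors_Psi2_image p_pr specialH gen_e v_dual k_dual).
apply/mprime_eq0; apply: generated_min; first exact: is_subgroup_Psi2_image specialH.
move=> _ [w ->]; have -> : w ^+ p = 1.
  have /exponentP : (exponent (whole H) %| p)%N by rewrite expH.
  by apply; rewrite finset.in_setT.
rewrite subg_derived1 tens1l.
exact: (proj1 (is_subgroup_Psi2_image specialH)).
Qed.

End Counting.

(** Here N is the dimension of T and k that of Im Psi2; the divisions by 6 and 3 are exact. *)
Lemma rank_arith d (k := 'C(d, 3)) (N := ('C(d, 2) * d)%N) :
  [/\ (d * (d - 1) * (d - 2) %/ 6 = k)%N & (d * (d - 1) * (d + 1) %/ 3 = N - k)%N].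
Proof.
have E3 : (d * (d - 1) * (d - 2) = k * 6)%N.
  rewrite /k -[6]/(3`!) bin_ffact !ffactnS ffactn0 muln1 -!subn1 mulnA.
  by case: (d) => [|[|n]].
have E2 : (d * (d - 1) = 'C(d, 2) * 2)%N.
  by rewrite -[2 in RHS]/(2`!) bin_ffact !ffactnS ffactn0 muln1 -subn1.
split; first by rewrite E3 mulnK.
have -> : (d * (d - 1) * (d + 1) = (N - k) * 3)%N; last by rewrite mulnK.
(* Doubling both sides produces the multiples 6 N and 6 k, which have polynomial forms. *)
apply/eqP; rewrite -(eqn_pmul2r (isT : 0 < 2)%N) -[(_ * 3 * 2)%N]mulnA mulnBl -E3.
have -> : (N * 6 = d * (d - 1) * (3 * d))%N by rewrite E2 /N; lia.
rewrite -mulnBr -mulnA; apply/eqP; case: (d) => [|[|n]] //; congr (_ * _)%N; lia.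
Qed.

Theorem theorem2p2 (p d : nat) (H : finGroupType) (X : choiceType)
    (phi : {multiplicative free_group X -> H}) :
  prime p -> p <> 2%N -> (3 <= d)%N ->
  special_pgroup p H -> 'm(whole H) = d ->
  #|derived H| = (p ^ (d * (d - 1) %/ 2))%N ->
  (forall h : H, exists x : free_group X, phi x = h) ->
  let n := (d * (d - 1) * (d + 1) %/ 3)%N in
  let k := (d * (d - 1) * (d - 2) %/ 6)%N in
  let m' := mprime H p in
  [/\ (m' <= n)%N,
      isomorphic (schur_multiplier phi) [set: elementary_abelian p (n - m')],
      isomorphic (kernel (beta phi)) [set: elementary_abelian p (k + m')]
    & #|` fset_set (range (Psi2 H))| = (p ^ k)%N] /\
  (isomorphic (schur_multiplier phi) [set: elementary_abelian p n] <->
   exponent (whole H) = p /\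
   isomorphic [set: H] [set: quotg (class2_relators p d)]).
Proof.
move=> p_pr p2 _ specialH rankH cardH' phi_onto n k m'.
have p_odd : odd p by case: (even_prime p_pr).
have [e gen_e] := generators_exist rankH.
have cosetC := commute_coset_derived specialH.
have cardV : #|{: coset_of (derived H)}| = (p ^ #|'I_d|)%N.
  by rewrite card_ord (card_coset_derived specialH rankH).
have [v v_dual] := dual_family_exists p_pr (fun _ _ => cosetC _ _)
  (fun _ => quotient_derived_exp p_pr specialH _) (generates_coset gen_e) cardV.
have cardD : #|{: subg_of (derived H)}| = (p ^ #|{: pairs d}|)%N.
  by rewrite card_pairs (card_subg_derived cardH').
have [c c_dual] := dual_family_exists p_pr
  (fun _ _ => commute_subg_derived specialH _ _)
  (fun _ => subg_derived_exp p_pr specialH _) (generates_pairs specialH gen_e) cardD.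
have [g [f [gK fK]]] := tensor_coordinates p_pr specialH gen_e v_dual c_dual.
have [kE nE] := rank_arith d.
have NE : #|{: pairs d * 'I_d}| = ('C(d, 2) * d)%N.
  by rewrite card_prod card_pairs card_ord.
have [kerI schurI] := isomorphic_ker_schur p_pr p_odd specialH gen_e v_dual c_dual
  phi_onto gK fK.
have bound := mprime_bound p_pr p_odd specialH gen_e v_dual c_dual phi_onto gK fK.
have m0 := mprime0_iff p_pr p_odd specialH gen_e v_dual c_dual gK fK.
rewrite NE -/m' -kE -/k in bound kerI schurI.
have nk : n = ('C(d, 2) * d - k)%N by rewrite /n nE /k kE.
have mn : (m' <= n)%N by rewrite nk leq_subRL ?(leq_trans (leq_addr m' k)).
have schurI' : isomorphic (schur_multiplier phi) [set: elementary_abelian p (n - m')].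
  by rewrite nk -subnDA.
split.
  split=> //.
  rewrite (card_fset_set_coordinates _ gK fK) /k kE.
  exact: (card_Psi2_image p_pr specialH gen_e v_dual c_dual gK fK).
split=> [schurN|[expH _]].
  have m'0 : m' = 0%N.
    (* The rank of an elementary abelian group is an invariant, so n - m' = n; as m' is at most n,
       it vanishes. *)
    have E := isomorphic_elementary_inj p_pr schurI' schurN.
    by apply/eqP; rewrite -(eqn_add2l (n - m')) subnK // E addn0.
  have expH : exponent (whole H) = p by apply/m0.
  split=> //.
  apply: (special_isomorphic_presented p_pr p_odd specialH gen_e v_dual c_dual) => i.
  have /exponentP : (exponent (whole H) %| p)%N by rewrite expH.
  by apply; rewrite finset.in_setT.
have m'0 : m' = 0%N by apply/m0.
by move: schurI'; rewrite m'0 subn0.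
Qed.
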